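(* For every integer $m\ge 1$, $$\sum_{n=1}^{\infty} \frac{\zeta(2n)}{n(2n+1)\cdots(2n+m)\,16^n} = \delta_{\lfloor \frac{m+1}{2} \rfloor, \frac{m+1}{2}}\frac{(-1)^{\frac{3m+1}{2}}2^m\,\beta(m+1)}{\pi^m} -\frac{1}{2}\,\delta_{\lfloor \frac{m}{2} \rfloor, \frac{m}{2}}\frac{(-1)^{\frac{3m}{2}}(2^{2m+1}+2^m-1)\,\zeta(m+1)}{(2\pi)^m} -\sum_{k=1}^{\lfloor \frac{m-1}{2} \rfloor} \frac{(-4)^k\,\zeta(2k+1)}{(m-2k)!\,\pi^{2k}}+ \frac{\log(\pi/2)-H_{m}}{m!}.$$
   Context: The denominator on the left is $n\cdot\prod_{i=1}^{m}(2n+i)\cdot 16^n$. $\zeta$ is the Riemann zeta function and $\beta(s)=\sum_{n=0}^\infty \frac{(-1)^n}{(2n+1)^s}$ is the Dirichlet beta function. $H_m=\sum_{i=1}^m \frac1i$ is the $m$-th harmonic number. $\delta_{a,b}$ is the Kronecker delta, so $\delta_{\lfloor n/2\rfloor,n/2}$ is $1$ if $n$ is even and $0$ if $n$ is odd; a term multiplied by it is read as $0$ when $n$ is odd. Empty sums are $0$. *)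

(* Defs.v *)
(** Everything here is over the classical real numbers [R] of Stdlib, with
    Coquelicot's limits and series. *)
From Stdlib Require Import Reals.
From Coquelicot Require Import Coquelicot.
Open Scope R_scope.

(** Dirichlet series of the Riemann zeta function; this is [zeta] only where
    the series converges, i.e. for [s > 1]. The index is shifted to start the
    summation at 1. *)
Definition zeta (s : R) : R := Series (fun n => / Rpower (INR (S n)) s).

(** Converges for [s > 0]. *)
Definition dirichlet_beta (s : R) : R :=
  Series (fun n => (-1) ^ n / Rpower (INR (2 * n + 1)) s).

Definition harmonic (m : nat) : R := sum_n_m (fun i => / INR i) 1 m.

(** Indexed by reals, so that it can compare [floor (m / 2)] with [m / 2]. *)
Definition kronecker (a b : R) : R := if Req_dec_T a b then 1 else 0.

(** The product of [f i] for [a <= i < a + k]. *)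
Fixpoint prod_from (f : nat -> R) (a k : nat) : R :=
  match k with
  | O => 1
  | S k' => prod_from f a k' * f (a + k')%nat
  end.

(* Main.v *)
Require Import Defs.
From Stdlib Require Import Reals Arith Lra Lia.
From Coquelicot Require Import Coquelicot.
Open Scope R_scope.

(** Up to the factor [4^m], the series is the [m]-fold antiderivative from 0, taken
    at [x = 1/4], of the sum of [zeta(2n) x^(2n) / n]. Euler's sine product
    identifies that sum with [ln (PI x / sin (PI x))] ([log_sine_series]), and the
    Fourier series [- ln (2 sin (PI x)) = sum cos(2 PI k x) / k]
    ([log_sine_fourier]) gives the second expansion
    [ln (2 PI x) + sum cos(2 PI k x) / k] of the same function. Integrating the
    latter [m] times from 0 produces
    - [x^m/m! (ln (2 PI x) - H_m)] from the logarithm, where the harmonic number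
      appears;
    - [sum cos(2 PI k x - m PI/2) / ((2 PI k)^m k)], which at [x = 1/4] is a multiple
      of [beta(m+1)] for odd [m] and of [zeta(m+1)] for even [m], since
      [cos((k - m) PI/2)] vanishes for half of the [k] and alternates on the others;
    - a polynomial in [x] cancelling the values of these cosine sums at 0, whose
      coefficients are the [zeta(2k+1)].

    All sums are kept finite, so that no limit has to be differentiated. The
    [defect] of level [m] is the difference of the two truncated expansions after
    [m] integrations; each level is the derivative of the next, and all levels
    [m >= 1] vanish at 0. The defect of level 0 tends to 0 uniformly away from
    [x = 0] only, as the Fourier series diverges there. Level 1 tends to 0
    uniformly on [(0, 1/4]] ([defect_1_uniform]) because it is also small near 0
    independently of the truncation, and the mean value inequality carries uniform
    convergence to all higher levels ([defect_uniform]).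

    The sine product comes from the integrals of [cos(2xt) cos^n t] over
    [[0, PI/2]], whose two-step recurrence ([cos_moment_rec]) produces one factor
    [1 - x^2/k^2] at a time, and the Fourier series from the closed form of the
    sum of [sin(2 k a)]. *)


(** * Finite sums and comparison of functions through their derivatives *)

Definition sum1 (f : nat -> R) (n : nat) : R := sum_n_m f 1 n.

Lemma sum1_0 f : sum1 f 0 = 0.
Proof. unfold sum1; rewrite sum_n_m_zero; [reflexivity | lia]. Qed.

Lemma sum1_S f n : sum1 f (S n) = sum1 f n + f (S n).
Proof. unfold sum1; rewrite sum_n_Sm; [reflexivity | lia]. Qed.

Lemma sum1_ext f g n :
  (forall k, (1 <= k <= n)%nat -> f k = g k) -> sum1 f n = sum1 g n.
Proof. intros H; apply sum_n_m_ext_loc; exact H. Qed.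

Lemma sum1_le f g n :
  (forall k, (1 <= k <= n)%nat -> f k <= g k) -> sum1 f n <= sum1 g n.
Proof.
induction n as [|n IH]; intros H.
- rewrite !sum1_0; lra.
- rewrite !sum1_S; apply Rplus_le_compat; [apply IH; intros k Hk|]; apply H; lia.
Qed.

Lemma sum1_plus f g n : sum1 (fun k => f k + g k) n = sum1 f n + sum1 g n.
Proof. induction n as [|n IH]; rewrite ?sum1_0, ?sum1_S; [lra | rewrite IH; lra]. Qed.

Lemma sum1_minus f g n : sum1 (fun k => f k - g k) n = sum1 f n - sum1 g n.
Proof. induction n as [|n IH]; rewrite ?sum1_0, ?sum1_S; [lra | rewrite IH; lra]. Qed.

Lemma sum1_scal c f n : sum1 (fun k => c * f k) n = c * sum1 f n.
Proof. induction n as [|n IH]; rewrite ?sum1_0, ?sum1_S; [lra | rewrite IH; lra]. Qed.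

Lemma sum1_Rabs f n : Rabs (sum1 f n) <= sum1 (fun k => Rabs (f k)) n.
Proof.
induction n as [|n IH]; rewrite ?sum1_0, ?sum1_S.
- rewrite Rabs_R0; lra.
- eapply Rle_trans; [apply Rabs_triang | lra].
Qed.

Lemma sum1_switch (f : nat -> nat -> R) n p :
  sum1 (fun i => sum1 (fun j => f i j) p) n = sum1 (fun j => sum1 (fun i => f i j) n) p.
Proof.
induction n as [|n IH].
- rewrite sum1_0; induction p as [|p IHp]; rewrite ?sum1_0, ?sum1_S, ?sum1_0; [lra|].
  rewrite <- IHp; lra.
- rewrite sum1_S, IH, <- sum1_plus; apply sum1_ext; intros j _; rewrite sum1_S; lra.
Qed.

Lemma sum1_0_ext f n : (forall k, (1 <= k <= n)%nat -> f k = 0) -> sum1 f n = 0.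
Proof.
intros H; rewrite (sum1_ext f (fun k => 0 * 0)), sum1_scal; [lra|].
intros k Hk; rewrite H; [lra | exact Hk].
Qed.

Lemma is_derive_sum1 (f : nat -> R -> R) (d : nat -> R) n x :
  (forall k, (1 <= k <= n)%nat -> is_derive (f k) x (d k)) ->
  is_derive (fun y => sum1 (fun k => f k y) n) x (sum1 d n).
Proof.
induction n as [|n IH]; intros H.
- apply (is_derive_ext (fun _ => 0)); [intros t; rewrite sum1_0; reflexivity|].
  rewrite sum1_0; apply (is_derive_const 0).
- apply (is_derive_ext (fun y => sum1 (fun k => f k y) n + f (S n) y));
    [intros t; rewrite sum1_S; reflexivity|].
  rewrite sum1_S; apply (is_derive_plus (fun y => sum1 (fun k => f k y) n)).
  + apply IH; intros k Hk; apply H; lia.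
  + apply H; lia.
Qed.

Lemma is_lim_seq_sum1 (u : nat -> nat -> R) (l : nat -> R) n :
  (forall k, (1 <= k <= n)%nat -> is_lim_seq (u k) (l k)) ->
  is_lim_seq (fun N => sum1 (fun k => u k N) n) (sum1 l n).
Proof.
induction n as [|n IH]; intros H.
- apply (is_lim_seq_ext (fun _ => 0)); [intros N; rewrite sum1_0; reflexivity|].
  rewrite sum1_0; apply is_lim_seq_const.
- apply (is_lim_seq_ext (fun N => sum1 (fun k => u k N) n + u (S n) N));
    [intros N; rewrite sum1_S; reflexivity|].
  rewrite sum1_S; apply is_lim_seq_plus'.
  + apply IH; intros k Hk; apply H; lia.
  + apply H; lia.
Qed.

Lemma is_series_sum1 (f : nat -> R) (l : R) :
  is_series (fun k => f (S k)) l <-> is_lim_seq (sum1 f) l.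
Proof.
assert (E : forall n, sum_n (fun k => f (S k)) n = sum1 f (S n)).
{ induction n as [|n IH].
  - rewrite sum_O, sum1_S, sum1_0; lra.
  - rewrite sum_Sn, IH, (sum1_S f (S n)); reflexivity. }
split; intros H.
- apply is_lim_seq_incr_1, (is_lim_seq_ext (sum_n (fun k => f (S k)))); [exact E | exact H].
- apply is_lim_seq_incr_1 in H.
  apply (is_lim_seq_ext _ (sum_n (fun k => f (S k)))) in H; [exact H | now intros n].
Qed.

(** Every estimate below that passes from a derivative to a function uses this
    mean value inequality. A variable bound [g'] is needed for the logarithmic
    series up to [z = 1], where a constant bound on the remainder's derivative
    does not tend to 0; only continuity is asked at the endpoints because
    [x ln x] has no derivative at 0. *)
Lemma derive_dominated (f g f' g' : R -> R) (a b : R) :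
  a <= b ->
  (forall t, a < t < b -> is_derive f t (f' t)) ->
  (forall t, a < t < b -> is_derive g t (g' t)) ->
  (forall t, a <= t <= b -> continuity_pt f t) ->
  (forall t, a <= t <= b -> continuity_pt g t) ->
  (forall t, a < t < b -> Rabs (f' t) <= g' t) ->
  Rabs (f b - f a) <= g b - g a.
Proof.
intros Hab Hf Hg Cf Cg Hle.
destruct (Req_dec a b) as [->|Hne].
{ rewrite !Rminus_diag, Rabs_R0; lra. }
assert (Hlt : a < b) by lra.
(* With [s = 1] and [s = -1], [g - s f] is nondecreasing. *)
assert (K : forall s : R, Rabs s <= 1 -> s * (f b - f a) <= g b - g a).
{ intros s Hs.
  assert (D : forall t, a < t < b ->
                derivable_pt_lim (fun y => g y - s * f y)%R t (g' t - s * f' t)).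
  { intros t Ht; apply is_derive_Reals.
    apply (is_derive_minus g (fun y => s * f y)); [now apply Hg|].
    apply (is_derive_scal f); now apply Hf. }
  pose (pr1 := fun c (P : a < c < b) =>
     exist (fun l => derivable_pt_lim (fun y => g y - s * f y) c l) _ (D c P)).
  pose (pr2 := fun c (P : a < c < b) => derivable_pt_id c).
  destruct (MVT (fun y => g y - s * f y) id a b pr1 pr2 Hlt) as [c [P E]].
  - intros c Hc; apply continuity_pt_minus; [now apply Cg|].
    apply continuity_pt_scal; now apply Cf.
  - intros c _; apply derivable_continuous_pt, derivable_pt_id.
  - rewrite derive_pt_id in E; unfold id in E; simpl in E.
    pose proof (Hle c P) as B.
    assert (0 <= g' c - s * f' c).
    { assert (s * f' c <= Rabs (f' c)).
      { eapply Rle_trans; [apply Rle_abs|]; rewrite Rabs_mult.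
        pose proof (Rabs_pos (f' c)); nra. }
      lra. }
    nra. }
apply Rabs_le; split.
- specialize (K (-1)); rewrite Rabs_left in K; lra.
- specialize (K 1); rewrite Rabs_R1 in K; lra.
Qed.

Lemma is_derive_continuity_pt (f : R -> R) (x l : R) : is_derive f x l -> continuity_pt f x.
Proof.
intros H; apply continuity_pt_filterlim, (ex_derive_continuous f); now exists l.
Qed.

Lemma geometric_sum (q : R) n : (1 - q) * sum1 (fun k => q ^ (k - 1)) n = 1 - q ^ n.
Proof.
induction n as [|n IH]; [rewrite sum1_0; simpl; lra|].
rewrite sum1_S, Rmult_plus_distr_l, IH; replace (S n - 1)%nat with n by lia; simpl; lra.
Qed.

Lemma inv_INR_S_lim (c : R) : is_lim_seq (fun n => c / (INR n + 1)) 0.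
Proof.
apply (is_lim_seq_ext (fun n => c * / INR (S n))).
{ intros n; rewrite S_INR; reflexivity. }
replace 0 with (c * 0) by lra; apply (is_lim_seq_scal_l _ c 0).
apply (is_lim_seq_incr_1 (fun n => / INR n)).
apply (is_lim_seq_inv _ p_infty); [apply is_lim_seq_INR | discriminate].
Qed.

(** Telescoping: [1/k^2 <= 1/(k-1) - 1/k]. *)
Lemma sum_inv_square_tail M N :
  (1 <= M <= N)%nat ->
  sum1 (fun k => / INR k ^ 2) N - sum1 (fun k => / INR k ^ 2) M <= / INR M - / INR N.
Proof.
intros [HM HN]; induction HN as [|N HN IH]; [lra|].
rewrite sum1_S, S_INR.
assert (0 < INR M) by (apply lt_0_INR; lia).
assert (0 < INR N) by (apply lt_0_INR; lia).
assert (E : / INR N - / (INR N + 1) - / (INR N + 1) ^ 2 = / (INR N * (INR N + 1) ^ 2))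
  by (field; lra).
assert (0 < / (INR N * (INR N + 1) ^ 2)).
{ apply Rinv_0_lt_compat, Rmult_lt_0_compat; [lra | apply pow_lt; lra]. }
lra.
Qed.

Lemma sum_inv_square_le N : sum1 (fun k => / INR k ^ 2) N <= 2.
Proof.
destruct N as [|N]; [rewrite sum1_0; lra|].
pose proof (sum_inv_square_tail 1 (S N) ltac:(lia)) as H.
rewrite (sum1_S _ 0), sum1_0 in H; simpl (INR 1) in H.
assert (0 < / INR (S N)) by (apply Rinv_0_lt_compat, lt_0_INR; lia).
lra.
Qed.


(** * Dirichlet series at integers *)

Lemma inv_pow_bounds k s : (1 <= k)%nat -> (2 <= s)%nat -> 0 < / INR k ^ s <= / INR k ^ 2.
Proof.
intros Hk Hs.
assert (1 <= INR k) by (apply (le_INR 1); lia).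
split; [apply Rinv_0_lt_compat, pow_lt; lra|].
apply Rinv_le_contravar; [apply pow_lt; lra | apply Rle_pow; [lra | lia]].
Qed.

Lemma inv_pow_summable (a : nat -> R) s :
  (2 <= s)%nat -> (forall k, Rabs (a k) <= / INR (S k) ^ s) -> ex_series a.
Proof.
intros Hs Ha.
apply (ex_series_le (V := R_CompleteNormedModule) a (fun k => / INR (S k) ^ 2)).
{ intros k; eapply Rle_trans; [apply Ha|]; apply inv_pow_bounds; lia. }
destruct (ex_finite_lim_seq_incr (sum1 (fun k => / INR k ^ 2)) 2) as [l Hl].
- intros n; rewrite sum1_S; pose proof (inv_pow_bounds (S n) 2 ltac:(lia) ltac:(lia)); lra.
- apply sum_inv_square_le.
- exists l; apply (is_series_sum1 (fun k => / INR k ^ 2)); exact Hl.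
Qed.

Lemma Rpower_INR k s : (1 <= k)%nat -> Rpower (INR k) (INR s) = INR k ^ s.
Proof. intros Hk; apply Rpower_pow, lt_0_INR; lia. Qed.

Lemma zeta_lim s :
  (2 <= s)%nat -> is_lim_seq (sum1 (fun k => / INR k ^ s)) (zeta (INR s)).
Proof.
intros Hs; apply (is_series_sum1 (fun k => / INR k ^ s)); unfold zeta.
rewrite (Series_ext _ (fun k => / INR (S k) ^ s)) by (intros k; rewrite Rpower_INR; [reflexivity | lia]).
apply Series_correct, (inv_pow_summable _ s); [exact Hs|].
intros k; rewrite Rabs_pos_eq; [lra|].
pose proof (inv_pow_bounds (S k) s ltac:(lia) Hs); lra.
Qed.

Lemma zeta_bounds s : (2 <= s)%nat -> 0 <= zeta (INR s) <= 2.
Proof.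
intros Hs; split.
- apply (is_lim_seq_le (fun _ => 0) (sum1 (fun k => / INR k ^ s)) 0 (zeta (INR s)));
    [|apply is_lim_seq_const | now apply zeta_lim].
  intros n; induction n as [|n IH]; [rewrite sum1_0; lra|].
  rewrite sum1_S; pose proof (inv_pow_bounds (S n) s ltac:(lia) Hs); lra.
- apply (is_lim_seq_le (sum1 (fun k => / INR k ^ s)) (fun _ => 2) (zeta (INR s)) 2);
    [|now apply zeta_lim | apply is_lim_seq_const].
  intros n; eapply Rle_trans; [|apply (sum_inv_square_le n)].
  apply sum1_le; intros k Hk; apply inv_pow_bounds; lia.
Qed.

Lemma beta_lim s :
  (2 <= s)%nat ->
  is_lim_seq (sum1 (fun k => (-1) ^ (k - 1) / INR (2 * k - 1) ^ s)) (dirichlet_beta (INR s)).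
Proof.
intros Hs; apply is_series_sum1; unfold dirichlet_beta.
rewrite (Series_ext _ (fun k => (-1) ^ (S k - 1) / INR (2 * S k - 1) ^ s)).
2:{ intros k; rewrite Rpower_INR by lia.
    replace (S k - 1)%nat with k by lia; now replace (2 * S k - 1)%nat with (2 * k + 1)%nat by lia. }
apply Series_correct, (inv_pow_summable _ s); [exact Hs|].
intros k; unfold Rdiv; rewrite Rabs_mult, pow_1_abs, Rmult_1_l, Rabs_pos_eq.
- apply Rinv_le_contravar; [apply pow_lt, lt_0_INR; lia|].
  apply pow_incr; split; [apply pos_INR | apply le_INR; lia].
- left; apply Rinv_0_lt_compat, pow_lt, lt_0_INR; lia.
Qed.

(** * The logarithmic series *)

(** Along the segment [1 + z s], [0 <= s <= 1], the derivative of the remainder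
    is exactly [z (- z s)^n / (1 + z s)] by the geometric sum. The bound [c]
    from below on that segment allows both [z = 1], which gives the alternating
    harmonic series, and negative [z] away from [-1]. *)
Lemma log_series (z c : R) n :
  0 < c -> c <= 1 -> c <= 1 + z ->
  Rabs (ln (1 + z) + sum1 (fun k => (- z) ^ k / INR k) n) <= Rabs z ^ S n / (INR (S n) * c).
Proof.
intros Hc Hc1 Hcz.
assert (Pos : forall s, 0 <= s <= 1 -> c <= 1 + z * s) by (intros s Hs; nra).
pose (f := fun s => ln (1 + z * s) + sum1 (fun k => (- z * s) ^ k / INR k) n).
pose (g := fun s => Rabs z ^ S n * s ^ S n / (INR (S n) * c)).
assert (HS : INR (S n) <> 0) by (apply not_0_INR; lia).
assert (Hf : forall s, 0 <= s <= 1 -> is_derive f s (z * (- z * s) ^ n / (1 + z * s))).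
{ intros s Hs; pose proof (Pos s Hs).
  replace (z * (- z * s) ^ n / (1 + z * s))
    with (z / (1 + z * s) + sum1 (fun k => - z * (- z * s) ^ (k - 1)) n).
  - apply (is_derive_plus (fun s => ln (1 + z * s))).
    + auto_derive; [lra | field; lra].
    + apply (is_derive_sum1 (fun k s => (- z * s) ^ k / INR k)); intros k Hk.
      auto_derive; [exact I|].
      replace (Init.Nat.pred k) with (k - 1)%nat by lia.
      field; apply not_0_INR; lia.
  - rewrite sum1_scal; pose proof (geometric_sum (- z * s) n) as G.
    apply (Rmult_eq_reg_l (1 + z * s)); [|lra].
    transitivity (z - z * ((1 - - z * s) * sum1 (fun k => (- z * s) ^ (k - 1)) n));
      [field; lra | rewrite G; field; lra]. }
assert (Hg : forall s, is_derive g s (Rabs z ^ S n * s ^ n / c)).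
{ intros s; unfold g; auto_derive; [exact I|].
  replace (match n with 0%nat => 1 | S _ => INR n + 1 end) with (INR (S n)) by reflexivity.
  simpl pow; field; split; [lra | exact HS]. }
assert (B : Rabs (f 1 - f 0) <= g 1 - g 0).
{ apply (derive_dominated f g (fun s => z * (- z * s) ^ n / (1 + z * s))
           (fun s => Rabs z ^ S n * s ^ n / c)); try lra.
  - intros s Hs; apply Hf; lra.
  - intros s Hs; apply Hg.
  - intros s Hs; eapply is_derive_continuity_pt, Hf; lra.
  - intros s Hs; eapply is_derive_continuity_pt, Hg.
  - intros s Hs; pose proof (Pos s ltac:(lra)).
    unfold Rdiv; rewrite !Rabs_mult, <- RPow_abs, Rabs_mult, Rabs_Ropp, (Rabs_pos_eq s) by lra.
    rewrite Rpow_mult_distr, Rabs_inv, (Rabs_pos_eq (1 + z * s)) by lra.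
    replace (Rabs z * (Rabs z ^ n * s ^ n)) with (Rabs z ^ S n * s ^ n) by (simpl; ring).
    apply Rmult_le_compat_l; [|apply Rinv_le_contravar; lra].
    apply Rmult_le_pos; apply pow_le; [apply Rabs_pos | lra]. }
unfold f, g in B; rewrite !Rmult_1_r, !Rmult_0_r, Rplus_0_r, ln_1, pow1, Rmult_1_r in B.
rewrite (sum1_0_ext (fun k => 0 ^ k / INR k)) in B.
2:{ intros k Hk; rewrite pow_i by lia; unfold Rdiv; ring. }
rewrite (pow_i (S n)) in B by lia; unfold Rdiv in B |- *.
rewrite !Rmult_0_r, !Rmult_0_l, Rplus_0_r, !Rminus_0_r in B.
exact B.
Qed.


(** * Euler's sine product *)

Definition cos_moment (x : R) (n : nat) : R :=
  RInt (fun t => cos (2 * x * t) * cos t ^ n) 0 (PI / 2).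

Lemma cos_moment_ex x n : ex_RInt (fun t => cos (2 * x * t) * cos t ^ n) 0 (PI / 2).
Proof.
apply (ex_RInt_continuous (V := R_CompleteNormedModule)); intros t _.
apply (ex_derive_continuous (fun t => cos (2 * x * t) * cos t ^ n)); auto_derive; exact I.
Qed.

(** Two integrations by parts, done at once through the antiderivative
    [n cos(2xt) cos^(n-1) t sin t - 2x sin(2xt) cos^n t] (with [n + 2] for [n]),
    which vanishes at both ends. Dividing by the instance [x = 0], an even index
    [2k] contributes the factor [1 - x^2/k^2] of the sine product. *)
Lemma cos_moment_rec x n :
  (INR (n + 2) ^ 2 - 4 * x ^ 2) * cos_moment x (n + 2)
  = INR (n + 2) * INR (n + 1) * cos_moment x n.
Proof.
pose (F := fun t => INR (n + 2) * (cos (2 * x * t) * cos t ^ (n + 1) * sin t)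
                    - 2 * x * (sin (2 * x * t) * cos t ^ (n + 2))).
pose (a := INR (n + 2) ^ 2 - 4 * x ^ 2).
pose (b := INR (n + 2) * INR (n + 1)).
pose (df := fun t => a * (cos (2 * x * t) * cos t ^ (n + 2)) - b * (cos (2 * x * t) * cos t ^ n)).
assert (HI : is_RInt df 0 (PI / 2) (F (PI / 2) - F 0)).
{ apply (is_RInt_derive (V := R_CompleteNormedModule) F df).
  - intros t _; unfold F, df; auto_derive; [exact I|].
    replace (n + 2)%nat with (S (S n)) by lia; replace (n + 1)%nat with (S n) by lia.
    unfold a, b; rewrite !plus_INR; simpl (INR 1); simpl (INR 2); rewrite !S_INR.
    simpl Init.Nat.pred. simpl pow.
    assert (Hs : sin t * sin t = 1 - cos t * cos t)
      by (pose proof (sin2_cos2 t) as H; unfold Rsqr in H; lra).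
    ring_simplify; replace (sin t ^ 2) with (1 - cos t ^ 2) by (simpl; lra); ring.
  - intros t _; apply (ex_derive_continuous df); unfold df; auto_derive; exact I. }
assert (HJ : is_RInt df 0 (PI / 2) (a * cos_moment x (n + 2) - b * cos_moment x n)).
{ unfold df; apply (is_RInt_minus (V := R_NormedModule));
    apply (is_RInt_scal (V := R_NormedModule)); apply (RInt_correct (V := R_CompleteNormedModule)), cos_moment_ex. }
pose proof (is_RInt_unique (V := R_CompleteNormedModule) _ _ _ _ HI) as EI.
pose proof (is_RInt_unique (V := R_CompleteNormedModule) _ _ _ _ HJ) as EJ.
rewrite EI in EJ.
assert (E : F (PI / 2) - F 0 = 0).
{ unfold F; rewrite cos_PI2, !Rmult_0_r, sin_0, !pow_i by lia; ring. }
unfold a, b in *; lra.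
Qed.

Lemma cos_moment_pos n : 0 < cos_moment 0 n.
Proof.
apply RInt_gt_0; [pose proof PI_RGT_0; lra| |].
- intros t Ht; rewrite Rmult_0_r, Rmult_0_l, cos_0, Rmult_1_l; apply pow_lt, cos_gt_0; pose proof PI_RGT_0; lra.
- intros t _; apply (ex_derive_continuous (fun t => cos (2 * 0 * t) * cos t ^ n)); auto_derive; exact I.
Qed.

Lemma cos_moment_0 x : 0 < x -> cos_moment x 0 = sin (PI * x) / (2 * x).
Proof.
intros Hx.
assert (H : is_RInt (fun t => cos (2 * x * t) * cos t ^ 0) 0 (PI / 2)
              (sin (2 * x * (PI / 2)) / (2 * x) - sin (2 * x * 0) / (2 * x))).
{ apply (is_RInt_derive (V := R_CompleteNormedModule) (fun t => sin (2 * x * t) / (2 * x))).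
  - intros t _; auto_derive; [exact I | field; lra].
  - intros t _; apply (ex_derive_continuous (fun t => cos (2 * x * t) * cos t ^ 0)); auto_derive; exact I. }
unfold cos_moment; rewrite (is_RInt_unique (V := R_CompleteNormedModule) _ _ _ _ H).
rewrite Rmult_0_r, sin_0; replace (2 * x * (PI / 2)) with (PI * x) by field; field; lra.
Qed.

Lemma cos_moment_0_0 : cos_moment 0 0 = PI / 2.
Proof.
unfold cos_moment; rewrite (RInt_ext _ (fun _ => 1)).
- rewrite RInt_const; unfold scal; simpl; unfold mult; simpl; lra.
- intros t _; rewrite Rmult_0_r, Rmult_0_l, cos_0; simpl; lra.
Qed.

(** For [0 <= x <= 1] and [0 <= t <= PI/2] the cosine decreases between [2xt]
    and [2t], so [cos (2xt) >= cos (2t) = 2 cos^2 t - 1]; the integral of this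
    lower bound against [cos^n t] is known from the recurrence at [x = 0]. Hence
    the ratio of the moments at [x] and at 0 tends to 1. *)
Lemma cos_moment_ratio_bounds x n :
  0 <= x <= 1 ->
  (1 - 2 / INR (n + 2)) * cos_moment 0 n <= cos_moment x n <= cos_moment 0 n.
Proof.
intros Hx; pose proof PI_RGT_0 as Hpi.
split.
- assert (E : 2 * cos_moment 0 (n + 2) - cos_moment 0 n = (1 - 2 / INR (n + 2)) * cos_moment 0 n).
  { pose proof (cos_moment_rec 0 n) as R.
    assert (INR (n + 2) <> 0) by (apply not_0_INR; lia).
    assert (E1 : INR (n + 1) = INR (n + 2) - 1) by (rewrite !plus_INR; simpl; lra).
    rewrite E1 in R.
    apply (Rmult_eq_reg_l (INR (n + 2) ^ 2)); [|apply pow_nonzero; assumption].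
    transitivity (2 * ((INR (n + 2) ^ 2 - 4 * 0 ^ 2) * cos_moment 0 (n + 2))
                  - INR (n + 2) ^ 2 * cos_moment 0 n); [ring | rewrite R; field; assumption]. }
  rewrite <- E.
  assert (H : is_RInt (fun t => 2 * (cos (2 * 0 * t) * cos t ^ (n + 2)) - cos (2 * 0 * t) * cos t ^ n)
                0 (PI / 2) (2 * cos_moment 0 (n + 2) - cos_moment 0 n)).
  { apply (is_RInt_minus (V := R_NormedModule));
      [apply (is_RInt_scal (V := R_NormedModule))|];
      apply (RInt_correct (V := R_CompleteNormedModule)), cos_moment_ex. }
  rewrite <- (is_RInt_unique (V := R_CompleteNormedModule) _ _ _ _ H).
  apply RInt_le; [lra | eexists; exact H | apply cos_moment_ex|].
  intros t Ht; rewrite Rmult_0_r, Rmult_0_l, cos_0.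
  replace (n + 2)%nat with (S (S n)) by lia; simpl pow.
  assert (0 < cos t) by (apply cos_gt_0; lra).
  assert (0 < cos t ^ n) by (apply pow_lt; assumption).
  assert (cos (2 * t) <= cos (2 * x * t)) by (apply cos_decr_1; nra).
  rewrite cos_2a_cos in H2; nra.
- apply RInt_le; [lra | apply cos_moment_ex | apply cos_moment_ex|].
  intros t Ht; rewrite Rmult_0_r, Rmult_0_l, cos_0.
  apply Rmult_le_compat_r; [apply pow_le; left; apply cos_gt_0; lra | apply COS_bound].
Qed.

(** The recurrence turns the product into a quotient of moments, and the moments
    of order 0 supply [sin (PI x) / (PI x)]. *)
Lemma sine_product x K :
  0 < x < 1 ->
  sum1 (fun k => - ln (1 - x ^ 2 / INR k ^ 2)) K
  = ln (PI * x / sin (PI * x)) + ln (cos_moment x (2 * K) / cos_moment 0 (2 * K)).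
Proof.
intros Hx; pose proof PI_RGT_0 as Hpi.
assert (Hsin : 0 < sin (PI * x)) by (apply sin_gt_0; nra).
assert (Hpos : forall k, 0 < cos_moment x (2 * k)).
{ induction k as [|k IH].
  - rewrite cos_moment_0 by lra; apply Rdiv_lt_0_compat; lra.
  - pose proof (cos_moment_rec x (2 * k)) as R.
    replace (2 * S k)%nat with (2 * k + 2)%nat by lia.
    assert (0 <= INR (2 * k)) by apply pos_INR.
    rewrite !plus_INR in R; change (INR 1) with 1 in R; change (INR 2) with 2 in R.
    assert (0 < (INR (2 * k) + 2) * (INR (2 * k) + 1) * cos_moment x (2 * k)).
    { apply Rmult_lt_0_compat; [nra | exact IH]. }
    apply (Rmult_lt_reg_l ((INR (2 * k) + 2) ^ 2 - 4 * x ^ 2)); [nra|].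
    rewrite Rmult_0_r, R; assumption. }
induction K as [|K IH].
- change (2 * 0)%nat with 0%nat; rewrite sum1_0, cos_moment_0, cos_moment_0_0 by lra.
  rewrite <- ln_mult.
  + replace (_ * _) with 1 by (field; lra); now rewrite ln_1.
  + apply Rdiv_lt_0_compat; nra.
  + apply Rdiv_lt_0_compat; [apply Rdiv_lt_0_compat|]; lra.
- rewrite sum1_S, IH, <- ln_Rinv, Rplus_assoc, <- ln_mult.
  2:{ apply Rdiv_lt_0_compat; [apply Hpos | apply cos_moment_pos]. }
  2:{ apply Rinv_0_lt_compat; rewrite S_INR; pose proof (pos_INR K).
      assert (x ^ 2 / (INR K + 1) ^ 2 < 1); [|lra].
      apply (Rmult_lt_reg_r ((INR K + 1) ^ 2)); [nra|]; unfold Rdiv.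
      rewrite Rmult_assoc, Rinv_l by nra; nra. }
  2:{ rewrite S_INR; pose proof (pos_INR K).
      assert (x ^ 2 / (INR K + 1) ^ 2 < 1); [|lra].
      apply (Rmult_lt_reg_r ((INR K + 1) ^ 2)); [nra|]; unfold Rdiv.
      rewrite Rmult_assoc, Rinv_l by nra; nra. }
  do 2 f_equal.
  pose proof (cos_moment_rec x (2 * K)) as R; pose proof (cos_moment_rec 0 (2 * K)) as R0.
  replace (2 * S K)%nat with (2 * K + 2)%nat by lia.
  pose proof (cos_moment_pos (2 * K)); pose proof (cos_moment_pos (2 * K + 2)).
  pose proof (Hpos K); pose proof (Hpos (S K)) as P; replace (2 * S K)%nat with (2 * K + 2)%nat in P by lia.
  pose proof (pos_INR K).
  rewrite !plus_INR, mult_INR in R, R0; change (INR 1) with 1 in R, R0; change (INR 2) with 2 in R, R0.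
  rewrite S_INR.
  assert (E : cos_moment x (2 * K) = (4 * (INR K + 1) ^ 2 - 4 * x ^ 2) * cos_moment x (2 * K + 2)
              / ((2 * INR K + 2) * (2 * INR K + 1))).
  { rewrite <- (Rmult_1_l (cos_moment x (2 * K))).
    apply (Rmult_eq_reg_l ((2 * INR K + 2) * (2 * INR K + 1))); [|nra].
    transitivity ((2 * INR K + 2) * (2 * INR K + 1) * cos_moment x (2 * K)); [ring|].
    rewrite <- R; field; nra. }
  assert (E0 : cos_moment 0 (2 * K) = 4 * (INR K + 1) ^ 2 * cos_moment 0 (2 * K + 2)
              / ((2 * INR K + 2) * (2 * INR K + 1))).
  { rewrite <- (Rmult_1_l (cos_moment 0 (2 * K))).
    apply (Rmult_eq_reg_l ((2 * INR K + 2) * (2 * INR K + 1))); [|nra].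
    transitivity ((2 * INR K + 2) * (2 * INR K + 1) * cos_moment 0 (2 * K)); [ring|].
    rewrite <- R0; field; nra. }
  rewrite E, E0; field; repeat split; nra.
Qed.

Lemma sine_product_lim x :
  0 < x < 1 ->
  is_lim_seq (sum1 (fun k => - ln (1 - x ^ 2 / INR k ^ 2))) (ln (PI * x / sin (PI * x))).
Proof.
intros Hx.
apply (is_lim_seq_ext
  (fun K => ln (PI * x / sin (PI * x)) + ln (cos_moment x (2 * K) / cos_moment 0 (2 * K)))).
{ intros K; symmetry; now apply sine_product. }
replace (Finite (ln (PI * x / sin (PI * x)))) with (Finite (ln (PI * x / sin (PI * x)) + ln 1))
  by (rewrite ln_1; f_equal; lra).
apply is_lim_seq_plus'; [apply is_lim_seq_const|].
apply (is_lim_seq_continuous ln); [apply continuity_pt_filterlim, (continuous_ln 1); lra|].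
apply (is_lim_seq_le_le (fun K => 1 - 1 / (INR K + 1)) _ (fun _ => 1)).
- intros K; pose proof (cos_moment_pos (2 * K)).
  pose proof (cos_moment_ratio_bounds x (2 * K) ltac:(lra)) as [B1 B2].
  replace (2 / INR (2 * K + 2)) with (1 / (INR K + 1)) in B1.
  2:{ rewrite plus_INR, mult_INR; simpl (INR 2); pose proof (pos_INR K); field; lra. }
  split; apply (Rmult_le_reg_r (cos_moment 0 (2 * K))); try assumption; unfold Rdiv at 1;
    rewrite ?(Rmult_assoc (cos_moment x (2 * K))), ?Rinv_l by lra; try lra.
  unfold Rdiv; rewrite (Rmult_assoc (cos_moment x (2 * K))), Rinv_l by lra; unfold Rdiv in B1; lra.
- replace (Finite 1) with (Finite (1 - 0)) by (f_equal; lra).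
  apply is_lim_seq_minus'; [apply is_lim_seq_const | apply inv_INR_S_lim].
- apply is_lim_seq_const.
Qed.


(** * The generating series of the even zeta values *)

(** The [m]-fold antiderivative, from 0, of the truncated series of
    [zeta(2n) x^(2n) / n]. *)
Definition zeta_part (m N : nat) (x : R) : R :=
  sum1 (fun n => zeta (INR (2 * n)) * x ^ (2 * n + m)
                 / (INR n * prod_from (fun i => INR (2 * n + i)) 1 m)) N.

(** Expanding each [- ln (1 - x^2/k^2)] of the sine product and exchanging the
    sums over [k] and [n]. The exchange is made for finitely many [k], where the
    remainder of the logarithmic series is at most [2 / (k^2 (N + 1))]; the
    number of factors tends to infinity only afterwards. *)
Lemma log_sine_series x N :
  0 < x <= 1 / 4 ->
  Rabs (ln (PI * x / sin (PI * x)) - zeta_part 0 N x) <= 4 / (INR N + 1).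
Proof.
intros Hx.
pose (D := fun K => sum1 (fun k => - ln (1 - x ^ 2 / INR k ^ 2)) K
                    - sum1 (fun n => x ^ (2 * n) / INR n * sum1 (fun k => / INR k ^ (2 * n)) K) N).
assert (LD : is_lim_seq D (ln (PI * x / sin (PI * x)) - zeta_part 0 N x)).
{ apply is_lim_seq_minus'; [apply sine_product_lim; lra|].
  unfold zeta_part; simpl prod_from.
  rewrite (sum1_ext _ (fun n => x ^ (2 * n) / INR n * zeta (INR (2 * n)))).
  2:{ intros n Hn; rewrite Nat.add_0_r; field; apply not_0_INR; lia. }
  apply (is_lim_seq_sum1 (fun n K => x ^ (2 * n) / INR n * sum1 (fun k => / INR k ^ (2 * n)) K)).
  intros n Hn; apply (is_lim_seq_scal_l _ _ (zeta (INR (2 * n)))), zeta_lim; lia. }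
apply is_lim_seq_abs in LD.
apply (is_lim_seq_le (fun K => Rabs (D K)) (fun _ => 4 / (INR N + 1))
         (Rabs (ln (PI * x / sin (PI * x)) - zeta_part 0 N x)) (4 / (INR N + 1)));
  [|exact LD | apply is_lim_seq_const].
intros K; unfold D.
rewrite (sum1_ext (fun n => _ * _) (fun n => sum1 (fun k => (x ^ 2 / INR k ^ 2) ^ n / INR n) K) N).
2:{ intros n Hn; rewrite <- sum1_scal; apply sum1_ext; intros k Hk.
    unfold Rdiv; rewrite Rpow_mult_distr, pow_inv, !pow_mult; ring. }
rewrite sum1_switch, <- sum1_minus.
eapply Rle_trans; [apply sum1_Rabs|].
pose proof (pos_INR N).
apply (Rle_trans _ (sum1 (fun k => 2 / (INR N + 1) * / INR k ^ 2) K)).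
- apply sum1_le; intros k Hk.
  assert (1 <= INR k) by (apply (le_INR 1); lia).
  pose proof (inv_pow_bounds k 2 ltac:(lia) ltac:(lia)) as B.
  assert (/ INR k ^ 2 <= 1).
  { rewrite <- Rinv_1; apply Rinv_le_contravar; [lra|]. rewrite <- (pow1 2); apply pow_incr; lra. }
  set (y := x ^ 2 / INR k ^ 2).
  assert (Hy : 0 < y <= 1 / 16 * / INR k ^ 2).
  { unfold y, Rdiv; split; [apply Rmult_lt_0_compat; nra|].
    apply Rmult_le_compat_r; [lra | nra]. }
  pose proof (log_series (- y) (1 / 2) N ltac:(lra) ltac:(lra) ltac:(lra)) as L.
  rewrite Rabs_Ropp, (Rabs_pos_eq y), Ropp_involutive in L by lra.
  replace (- ln (1 - y) - sum1 (fun n => y ^ n / INR n) N)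
    with (- (ln (1 + - y) + sum1 (fun n => y ^ n / INR n) N))
    by (replace (1 + - y) with (1 - y) by lra; ring).
  rewrite Rabs_Ropp; eapply Rle_trans; [exact L|].
  rewrite S_INR.
  replace (y ^ S N / ((INR N + 1) * (1 / 2))) with (2 / (INR N + 1) * y ^ S N) by (field; lra).
  apply Rmult_le_compat_l; [apply Rlt_le, Rdiv_lt_0_compat; lra|].
  simpl pow at 1.
  assert (0 <= y ^ N <= 1).
  { split; [apply pow_le; lra|]. rewrite <- (pow1 N); apply pow_incr; lra. }
  nra.
- rewrite sum1_scal; pose proof (sum_inv_square_le K).
  replace (4 / (INR N + 1)) with (2 / (INR N + 1) * 2) by (field; lra).
  apply Rmult_le_compat_l; [apply Rlt_le, Rdiv_lt_0_compat; lra | assumption].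
Qed.

(** * The Fourier series of the logarithm of the sine *)

Lemma cos_INR_PI k : cos (INR k * PI) = (-1) ^ k.
Proof.
induction k as [|k IH]; [rewrite Rmult_0_l, cos_0; reflexivity|].
rewrite S_INR, Rmult_plus_distr_r, Rmult_1_l, neg_cos, IH; simpl; ring.
Qed.

Lemma sin_INR_PI k : sin (INR k * PI) = 0.
Proof.
induction k as [|k IH]; [now rewrite Rmult_0_l, sin_0|].
rewrite S_INR, Rmult_plus_distr_r, Rmult_1_l, neg_sin, IH; ring.
Qed.

Lemma conjugate_dirichlet_kernel a N :
  sin a * (2 * sum1 (fun k => sin (2 * INR k * a)) N) = cos a - cos ((2 * INR N + 1) * a).
Proof.
induction N as [|N IH].
- rewrite sum1_0; simpl INR; rewrite !Rmult_0_r, Rplus_0_l, Rmult_1_l; lra.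
- rewrite sum1_S, !Rmult_plus_distr_l, IH, S_INR.
  replace ((2 * INR N + 1) * a) with (2 * (INR N + 1) * a - a) by ring.
  replace ((2 * (INR N + 1) + 1) * a) with (2 * (INR N + 1) * a + a) by ring.
  rewrite cos_minus, cos_plus; ring.
Qed.

(** The derivative of the left side is [PI cos((2N+1) PI t) / sin(PI t)], which
    does not tend to 0 but oscillates. Subtracting
    [sin((2N+1) PI t) / ((2N+1) sin(PI t))], the result of one integration by
    parts, leaves a derivative of order [1/N]. The comparison starts at
    [t = 1/2], where the claim is the alternating harmonic series for [ln 2]. *)
Lemma log_sine_fourier N x :
  0 < x <= 1 / 2 ->
  Rabs (sum1 (fun k => cos (2 * PI * INR k * x) / INR k) N + ln (2 * sin (PI * x)))
    <= 7 / ((INR N + 1) * sin (PI * x) ^ 2).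
Proof.
intros Hx; pose proof PI_RGT_0 as Hpi; pose proof PI_4 as Hpi4; pose proof (pos_INR N) as HN.
set (s := sin (PI * x)).
assert (Hsin : forall t, x <= t <= 1 / 2 -> s <= sin (PI * t)).
{ intros t Ht; apply sin_incr_1; nra. }
assert (Hs : 0 < s) by (apply sin_gt_0; nra).
assert (Hs1 : s <= 1) by apply SIN_bound.
(* [W] is the left side corrected by the oscillating term [V]. *)
pose (V := fun t => sin ((2 * INR N + 1) * (PI * t)) / ((2 * INR N + 1) * sin (PI * t))).
pose (W := fun t => sum1 (fun k => cos (2 * PI * INR k * t) / INR k) N + ln (2 * sin (PI * t)) - V t).
pose (W' := fun t => PI * sin ((2 * INR N + 1) * (PI * t)) * cos (PI * t)
                     / ((2 * INR N + 1) * sin (PI * t) ^ 2)).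
assert (HW : forall t, x <= t <= 1 / 2 -> is_derive W t (W' t)).
{ intros t Ht; pose proof (Hsin t Ht) as St.
  replace (W' t) with
    (sum1 (fun k => - (2 * PI) * sin (2 * INR k * (PI * t))) N + PI * cos (PI * t) / sin (PI * t)
     - (PI * cos ((2 * INR N + 1) * (PI * t)) / sin (PI * t) - W' t)).
  - apply (is_derive_minus (fun t => sum1 (fun k => cos (2 * PI * INR k * t) / INR k) N
                                     + ln (2 * sin (PI * t))) V).
    + apply (is_derive_plus (fun t => sum1 (fun k => cos (2 * PI * INR k * t) / INR k) N)).
      * apply (is_derive_sum1 (fun k t => cos (2 * PI * INR k * t) / INR k)); intros k Hk.
        auto_derive; [exact I|].
        replace (2 * INR k * (PI * t)) with (2 * PI * INR k * t) by ring.
        field; apply not_0_INR; lia.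
      * auto_derive; [lra | field; lra].
    + unfold V, W'; auto_derive; [nra | field; nra].
  - rewrite sum1_scal; pose proof (conjugate_dirichlet_kernel (PI * t) N) as K.
    apply (Rmult_eq_reg_l (sin (PI * t))); [|lra].
    transitivity (- PI * (sin (PI * t) * (2 * sum1 (fun k => sin (2 * INR k * (PI * t))) N))
      + PI * cos (PI * t) - PI * cos ((2 * INR N + 1) * (PI * t)) + sin (PI * t) * W' t);
      [field; lra | rewrite K; ring]. }
pose (e := / (INR N + 1)).
assert (He : 0 < e) by (apply Rinv_0_lt_compat; lra).
assert (He2 : / (2 * INR N + 1) <= e) by (apply Rinv_le_contravar; lra).
assert (He0 : 0 < / (2 * INR N + 1)) by (apply Rinv_0_lt_compat; lra).
assert (Hs2 : 1 <= / s ^ 2).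
{ rewrite <- Rinv_1; apply Rinv_le_contravar; nra. }
assert (Hs3 : / s <= / s ^ 2) by (apply Rinv_le_contravar; nra).
(* At [x] and at 1/2 the correction itself is of order [1/N]. *)
assert (BV : forall t, x <= t <= 1 / 2 -> Rabs (V t) <= e * / s ^ 2).
{ intros t Ht; pose proof (Hsin t Ht) as St.
  unfold V, Rdiv; rewrite Rabs_mult, Rinv_mult, (Rabs_pos_eq (_ * / _)).
  2:{ apply Rmult_le_pos; [lra | apply Rlt_le, Rinv_0_lt_compat; lra]. }
  assert (Rabs (sin ((2 * INR N + 1) * (PI * t))) <= 1) by (apply Rabs_le, SIN_bound).
  assert (0 < / sin (PI * t)) by (apply Rinv_0_lt_compat; lra).
  assert (/ sin (PI * t) <= / s) by (apply Rinv_le_contravar; lra).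
  rewrite <- (Rmult_1_l (e * / s ^ 2)).
  apply Rmult_le_compat; try lra; [apply Rabs_pos | nra | apply Rmult_le_compat; lra]. }
assert (B1 : Rabs (W (1 / 2) - W x) <= 4 * (e * / s ^ 2)).
{ eapply Rle_trans;
    [apply (derive_dominated W (fun t => 4 * (e * / s ^ 2) * 2 * t) W' (fun _ => 4 * (e * / s ^ 2) * 2)); try lra|].
  - intros t Ht; apply HW; lra.
  - intros t Ht; auto_derive; [exact I | simpl; ring].
  - intros t Ht; eapply is_derive_continuity_pt, HW; lra.
  - intros t Ht; apply derivable_continuous_pt; reg.
  - intros t Ht; pose proof (Hsin t ltac:(lra)) as St.
    unfold W', Rdiv; rewrite Rinv_mult, !Rabs_mult, (Rabs_pos_eq PI), (Rabs_pos_eq (/ (_ + _))),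
      (Rabs_pos_eq (/ sin _ ^ 2)) by (try apply Rlt_le, Rinv_0_lt_compat; nra).
    assert (A1 : Rabs (sin ((2 * INR N + 1) * (PI * t))) <= 1) by (apply Rabs_le, SIN_bound).
    assert (A2 : Rabs (cos (PI * t)) <= 1) by (apply Rabs_le, COS_bound).
    assert (A3 : 0 < / sin (PI * t) ^ 2) by (apply Rinv_0_lt_compat; nra).
    assert (A4 : / sin (PI * t) ^ 2 <= / s ^ 2) by (apply Rinv_le_contravar; nra).
    pose proof (Rabs_pos (sin ((2 * INR N + 1) * (PI * t)))); pose proof (Rabs_pos (cos (PI * t))).
    assert (A5 : / (2 * INR N + 1) * / sin (PI * t) ^ 2 <= e * / s ^ 2)
      by (apply Rmult_le_compat; lra).
    assert (A6 : PI * Rabs (sin ((2 * INR N + 1) * (PI * t))) * Rabs (cos (PI * t)) <= 4).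
    { replace 4 with (4 * 1 * 1) by ring; apply Rmult_le_compat; [apply Rmult_le_pos; lra | lra | apply Rmult_le_compat; lra | lra]. }
    apply (Rle_trans _ (4 * (e * / s ^ 2))); [|assert (0 < e * / s ^ 2) by nra; lra].
    apply Rmult_le_compat; try lra; [|nra].
    apply Rmult_le_pos; [apply Rmult_le_pos|]; lra.
  - assert (0 < e * / s ^ 2) by nra; nra. }
assert (B2 : Rabs (sum1 (fun k => cos (2 * PI * INR k * (1 / 2)) / INR k) N + ln (2 * sin (PI * (1 / 2))))
             <= e).
{ replace (PI * (1 / 2)) with (PI / 2) by lra; rewrite sin_PI2, Rmult_1_r.
  rewrite (sum1_ext _ (fun k => (- (1)) ^ k / INR k)).
  2:{ intros k _; rewrite <- cos_INR_PI; do 2 f_equal; field. }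
  pose proof (log_series 1 1 N ltac:(lra) ltac:(lra) ltac:(lra)) as L.
  rewrite Rabs_R1, pow1, S_INR in L; unfold Rdiv in L; rewrite Rmult_1_l, Rmult_1_r in L.
  rewrite Rplus_comm; replace 2 with (1 + 1) by lra; exact L. }
pose proof (BV x ltac:(lra)) as V1; pose proof (BV (1 / 2) ltac:(lra)) as V2.
replace (7 / ((INR N + 1) * s ^ 2)) with (7 * (e * / s ^ 2)) by (unfold e; field; split; lra).
assert (e <= e * / s ^ 2) by nra.
unfold W in B1; fold s in B1.
revert B1 B2 V1 V2; unfold Rabs; repeat destruct Rcase_abs; lra.
Qed.


(** * Iterated antiderivatives *)

(** On [x > 0], the [m]-fold antiderivative from 0 of [ln (2 PI x)]. *)

Definition log_part (m : nat) (x : R) : R :=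
  x ^ m / INR (fact m) * (ln (2 * PI * x) - harmonic m).

(** The [m]-fold antiderivative of [cos(2 PI k x) / k], summed over [k <= N],
    obtained by shifting the phase; it need not vanish at 0, and [poly_part] is
    the Taylor polynomial at 0 that corrects this. *)
Definition cos_part (m N : nat) (x : R) : R :=
  sum1 (fun k => cos (2 * PI * INR k * x - INR m * (PI / 2)) / ((2 * PI * INR k) ^ m * INR k)) N.

Definition initial_value (N j : nat) : R :=
  cos (INR j * (PI / 2)) / (2 * PI) ^ j * sum1 (fun k => / INR k ^ (j + 1)) N.

Definition poly_part (m N : nat) (x : R) : R :=
  sum1 (fun j => initial_value N j * (x ^ (m - j) / INR (fact (m - j)))) m.

(** At level 0 this is the difference between the two expansions of
    [ln (PI x / sin (PI x))]. Both sums are cut at the same [N], so that each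
    level is exactly the derivative of the next one. *)
Definition defect (m N : nat) (x : R) : R :=
  zeta_part m N x - (log_part m x + (cos_part m N x - poly_part m N x)).

Lemma INR_fact_S n : INR (fact (S n)) = (INR n + 1) * INR (fact n).
Proof. rewrite fact_simpl, mult_INR, S_INR; reflexivity. Qed.

Lemma harmonic_S m : harmonic (S m) = harmonic m + / (INR m + 1).
Proof. unfold harmonic; rewrite <- S_INR; apply (sum1_S (fun i => / INR i)). Qed.

Lemma prod_from_pos n m : (1 <= n)%nat -> 0 < prod_from (fun i => INR (2 * n + i)) 1 m.
Proof.
intros Hn; induction m as [|m IH]; simpl prod_from; [lra|].
apply Rmult_lt_0_compat; [exact IH | apply lt_0_INR; lia].
Qed.

Lemma zeta_part_derive m N x : is_derive (zeta_part (S m) N) x (zeta_part m N x).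
Proof.
apply (is_derive_sum1 (fun n x => zeta (INR (2 * n)) * x ^ (2 * n + S m)
                        / (INR n * prod_from (fun i => INR (2 * n + i)) 1 (S m)))).
intros n Hn; pose proof (prod_from_pos n m ltac:(lia)).
cbn [prod_from]; change (1 + m)%nat with (S m).
set (p := prod_from _ _ _) in *.
assert (0 < INR n) by (apply lt_0_INR; lia).
assert (0 < INR (2 * n + S m)) by (apply lt_0_INR; lia).
auto_derive; [exact I|].
replace (Init.Nat.pred (n + (n + 0) + S m)) with (2 * n + m)%nat by lia.
replace (n + (n + 0) + S m)%nat with (2 * n + S m)%nat by lia.
replace (n + (n + 0))%nat with (2 * n)%nat by lia.
field; lra.
Qed.

Lemma log_part_derive m x : 0 < x -> is_derive (log_part (S m)) x (log_part m x).
Proof.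
intros Hx; pose proof PI_RGT_0; pose proof (pos_INR m); pose proof (INR_fact_lt_0 m).
assert (0 < 2 * PI * x) by nra.
unfold log_part; auto_derive; [assumption|].
change (Init.Nat.pred (S m)) with m.
replace (match m with 0%nat => 1 | S _ => INR m + 1 end) with (INR (S m)) by reflexivity.
change (fact m + m * fact m)%nat with (fact (S m)).
rewrite S_INR, INR_fact_S, harmonic_S; simpl pow; field; repeat split; lra.
Qed.

Lemma mul_ln_bound z : 0 < z <= 1 -> Rabs (z * ln z) <= 2 * sqrt z.
Proof.
intros Hz.
set (w := sqrt z).
assert (Hw : 0 < w) by (apply sqrt_lt_R0; lra).
assert (Ez : z = w * w) by (symmetry; apply sqrt_sqrt; lra).
assert (Hw1 : w <= 1) by nra.
assert (L : - ln w <= / w - 1).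
{ rewrite <- ln_Rinv by assumption.
  assert (Hi : 0 < / w) by (apply Rinv_0_lt_compat; assumption).
  pose proof (exp_ineq1_le (ln (/ w))) as E; rewrite exp_ln in E by assumption; lra. }
assert (L0 : ln w <= 0) by (rewrite <- ln_1; apply ln_le; lra).
assert (0 < w * w) by nra.
rewrite Ez, ln_mult, Rabs_left1 by (assumption || nra).
assert (w * - ln w <= 1).
{ apply (Rle_trans _ (w * (/ w - 1))); [apply Rmult_le_compat_l; lra|].
  rewrite Rmult_minus_distr_l, Rinv_r by lra; lra. }
replace (- (w * w * (ln w + ln w))) with (2 * w * (w * - ln w)) by ring; nra.
Qed.

(** The logarithm is 0 at nonpositive arguments, so the continuity at 0 is
    two-sided. *)
Lemma mul_ln_continuous_0 c : 0 < c -> continuity_pt (fun x => x * ln (c * x)) 0.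
Proof.
intros Hc e He.
exists (Rmin (/ c) (c * (e / 2) ^ 2)); split.
{ apply Rmin_pos; [now apply Rinv_0_lt_compat | apply Rmult_lt_0_compat; [lra | apply pow_lt; lra]]. }
intros x [_ Hx]; change (Rabs (x - 0) < Rmin (/ c) (c * (e / 2) ^ 2)) in Hx.
change (Rabs (x * ln (c * x) - 0 * ln (c * 0)) < e).
rewrite Rminus_0_r in Hx; rewrite Rmult_0_l, Rminus_0_r.
destruct (Rle_dec x 0) as [Hx0|Hx0].
- assert (E : ln (c * x) = 0).
  { unfold ln; destruct (Rlt_dec 0 (c * x)); [exfalso; nra | reflexivity]. }
  rewrite E, Rmult_0_r, Rabs_R0; assumption.
- assert (0 < x) by lra; rewrite Rabs_pos_eq in Hx by lra.
  pose proof (Rmin_l (/ c) (c * (e / 2) ^ 2)); pose proof (Rmin_r (/ c) (c * (e / 2) ^ 2)).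
  assert (B : 0 < c * x <= 1).
  { split; [nra|]; rewrite <- (Rinv_r c) by lra; apply Rmult_le_compat_l; lra. }
  apply mul_ln_bound in B.
  apply (Rmult_lt_reg_l c); [assumption|].
  replace (c * Rabs (x * ln (c * x))) with (Rabs (c * x * ln (c * x)))
    by (rewrite Rmult_assoc, Rabs_mult, (Rabs_pos_eq c) by lra; reflexivity).
  eapply Rle_lt_trans; [exact B|].
  assert (sqrt (c * x) < c * (e / 2)); [|lra].
  rewrite <- (sqrt_pow2 (c * (e / 2))) by nra.
  apply sqrt_lt_1; simpl in *; nra.
Qed.

Lemma log_part_continuous_0 m : continuity_pt (log_part (S m)) 0.
Proof.
pose proof (mul_ln_continuous_0 (2 * PI) ltac:(pose proof PI_RGT_0; lra)) as C.
pose proof (INR_fact_neq_0 (S m)).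
apply (continuity_pt_ext
  (fun x => x ^ m / INR (fact (S m)) * (x * ln (2 * PI * x) - harmonic (S m) * x))%R).
{ intros t; unfold log_part; simpl pow; field; assumption. }
apply (continuity_pt_mult (fun x => x ^ m / INR (fact (S m)))).
- apply (is_derive_continuity_pt _ _ _ (Derive_correct (fun x => x ^ m / INR (fact (S m))) 0 ltac:(auto_derive; exact I))).
- apply continuity_pt_minus; [exact C|].
  apply derivable_continuous_pt; reg.
Qed.

Lemma log_part_0 m : log_part (S m) 0 = 0.
Proof. unfold log_part; rewrite pow_i by lia; unfold Rdiv; ring. Qed.

Lemma cos_part_derive m N x : is_derive (cos_part (S m) N) x (cos_part m N x).
Proof.
pose proof PI_RGT_0.
apply (is_derive_sum1 (fun k x => cos (2 * PI * INR k * x - INR (S m) * (PI / 2))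
                                  / ((2 * PI * INR k) ^ S m * INR k))).
intros k Hk; assert (0 < INR k) by (apply lt_0_INR; lia).
assert (0 < (2 * PI * INR k) ^ m) by (apply pow_lt; nra).
replace (cos (2 * PI * INR k * x - INR m * (PI / 2)))
  with (- sin (2 * PI * INR k * x - INR (S m) * (PI / 2))).
- auto_derive; [exact I|].
  replace (match m with 0%nat => 1 | S _ => INR m + 1 end) with (INR (S m)) by reflexivity.
  unfold Rminus, Rdiv; simpl pow; field; repeat split; lra.
- rewrite S_INR.
  replace (2 * PI * INR k * x - INR m * (PI / 2))
    with (PI / 2 + (2 * PI * INR k * x - (INR m + 1) * (PI / 2))) by ring.
  rewrite sin_cos; apply Ropp_involutive.
Qed.


Lemma poly_part_derive m N x : is_derive (poly_part (S m) N) x (poly_part m N x).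
Proof.
unfold poly_part.
apply (is_derive_ext
  (fun x => sum1 (fun j => initial_value N j * (x ^ (S m - j) / INR (fact (S m - j)))) m
            + initial_value N (S m))).
{ intros t; rewrite sum1_S, Nat.sub_diag; simpl; field. }
rewrite <- (Rplus_0_r (sum1 _ m)).
apply (is_derive_plus (fun x => sum1 (fun j => initial_value N j * (x ^ (S m - j) / INR (fact (S m - j)))) m)
         (fun _ => initial_value N (S m))); [|apply (is_derive_const (initial_value N (S m)))].
apply (is_derive_sum1 (fun j x => initial_value N j * (x ^ (S m - j) / INR (fact (S m - j))))).
intros j Hj; replace (S m - j)%nat with (S (m - j)) by lia.
pose proof (INR_fact_lt_0 (m - j)); pose proof (pos_INR (m - j)).
auto_derive; [exact I|].
change (fact (m - j) + (m - j) * fact (m - j))%nat with (fact (S (m - j))).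
change (Init.Nat.pred (S (m - j))) with (m - j)%nat.
replace (match (m - j)%nat with 0%nat => 1 | S _ => INR (m - j) + 1 end) with (INR (S (m - j))) by reflexivity.
rewrite INR_fact_S, S_INR; field; lra.
Qed.

Lemma defect_derive m N x : 0 < x -> is_derive (defect (S m) N) x (defect m N x).
Proof.
intros Hx; unfold defect.
apply (is_derive_minus (zeta_part (S m) N)); [apply zeta_part_derive|].
apply (is_derive_plus (log_part (S m))); [now apply log_part_derive|].
apply (is_derive_minus (cos_part (S m) N)); [apply cos_part_derive | apply poly_part_derive].
Qed.

Lemma defect_continuous m N x : 0 <= x -> continuity_pt (defect (S m) N) x.
Proof.
intros [Hx | <-]; [eapply is_derive_continuity_pt, defect_derive; assumption|].
apply (continuity_pt_minus (zeta_part (S m) N)); [eapply is_derive_continuity_pt, zeta_part_derive|].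
apply (continuity_pt_plus (log_part (S m))); [apply log_part_continuous_0|].
apply (continuity_pt_minus (cos_part (S m) N)).
- eapply is_derive_continuity_pt, cos_part_derive.
- eapply is_derive_continuity_pt, poly_part_derive.
Qed.

Lemma defect_0 m N : defect (S m) N 0 = 0.
Proof.
unfold defect; rewrite log_part_0.
assert (Z : zeta_part (S m) N 0 = 0).
{ apply sum1_0_ext; intros n Hn; rewrite pow_i by lia; unfold Rdiv; ring. }
assert (Q : cos_part (S m) N 0 = poly_part (S m) N 0); [|lra].
unfold poly_part; rewrite sum1_S, sum1_0_ext, Nat.sub_diag, Rplus_0_l.
2:{ intros j Hj; rewrite pow_i by lia; unfold Rdiv; ring. }
simpl (_ / INR (fact 0)); unfold cos_part, initial_value.
rewrite Rdiv_1_r, Rmult_1_r, <- sum1_scal; apply sum1_ext; intros k Hk.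
rewrite Rmult_0_r, Rminus_0_l, cos_neg, Rpow_mult_distr, pow_add, pow_1.
assert (0 < INR k) by (apply lt_0_INR; lia); pose proof PI_RGT_0.
field; repeat split; try apply pow_nonzero; lra.
Qed.

Lemma defect_step m N c x :
  0 <= x -> (forall t, 0 < t < x -> Rabs (defect m N t) <= c) ->
  Rabs (defect (S m) N x) <= c * x.
Proof.
intros Hx Hc.
pose proof (derive_dominated (defect (S m) N) (fun t => c * t) (defect m N) (fun _ => c) 0 x Hx) as D.
rewrite defect_0, Rminus_0_r, Rmult_0_r, Rminus_0_r in D; apply D.
- intros t Ht; apply defect_derive; lra.
- intros t Ht; auto_derive; [exact I | ring].
- intros t Ht; apply defect_continuous; lra.
- intros t Ht; apply derivable_continuous_pt; reg.
- exact Hc.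
Qed.

(** The two expansions of [ln (PI x / sin (PI x))]; the bound blows up as [x]
    tends to 0. *)
Lemma defect_0_bound N x :
  0 < x <= 1 / 4 ->
  Rabs (defect 0 N x) <= 4 / (INR N + 1) + 7 / ((INR N + 1) * sin (PI * x) ^ 2).
Proof.
intros Hx; pose proof PI_RGT_0.
assert (0 < sin (PI * x)) by (apply sin_gt_0; nra).
assert (0 < PI * x) by nra.
pose proof (log_sine_series x N Hx) as A.
pose proof (log_sine_fourier N x ltac:(lra)) as B.
replace (defect 0 N x) with
  (- (ln (PI * x / sin (PI * x)) - zeta_part 0 N x)
   + - (sum1 (fun k => cos (2 * PI * INR k * x) / INR k) N + ln (2 * sin (PI * x)))).
{ eapply Rle_trans; [apply Rabs_triang|]; rewrite !Rabs_Ropp; lra. }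
assert (C : cos_part 0 N x = sum1 (fun k => cos (2 * PI * INR k * x) / INR k) N).
{ apply sum1_ext; intros k Hk; simpl INR.
  rewrite Rmult_0_l, Rminus_0_r, pow_O, Rmult_1_l; reflexivity. }
assert (P : poly_part 0 N x = 0) by apply sum1_0.
unfold defect, log_part; rewrite C, P.
assert (HH : harmonic 0 = 0) by (apply (sum1_0 (fun i => / INR i))); rewrite HH.
rewrite pow_O; simpl (INR (fact 0)).
replace (2 * PI * x) with (2 * sin (PI * x) * (PI * x / sin (PI * x))) by (field; lra).
rewrite (ln_mult (2 * sin (PI * x))); [field | lra | apply Rdiv_lt_0_compat; lra].
Qed.

(** Terms up to [M] are bounded by [|sin y| <= y], the others by [|sin y| <= 1].
    The bound does not depend on [N]. *)
Lemma sine_sum_small N M x :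
  (1 <= M)%nat -> 0 <= x ->
  Rabs (sum1 (fun k => sin (2 * PI * INR k * x) / INR k ^ 2) N) <= 2 * PI * x * INR M + / INR M.
Proof.
intros HM Hx; pose proof PI_RGT_0.
assert (0 < INR M) by (apply lt_0_INR; lia).
assert (0 < / INR M) by (apply Rinv_0_lt_compat; lra).
assert (A : forall n, (n <= M)%nat ->
  Rabs (sum1 (fun k => sin (2 * PI * INR k * x) / INR k ^ 2) n) <= 2 * PI * x * INR n).
{ induction n as [|n IH]; intros Hn; [rewrite sum1_0, Rabs_R0; simpl; lra|].
  rewrite sum1_S; eapply Rle_trans; [apply Rabs_triang|].
  specialize (IH ltac:(lia)); rewrite S_INR; pose proof (pos_INR n).
  assert (Rabs (sin (2 * PI * (INR n + 1) * x) / (INR n + 1) ^ 2) <= 2 * PI * x); [|lra].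
  set (y := 2 * PI * (INR n + 1) * x).
  assert (Hy : 0 <= y) by (apply Rmult_le_pos; nra).
  assert (Sy : Rabs (sin y) <= y).
  { pose proof (derive_dominated sin (fun t => t) cos (fun _ => 1) 0 y Hy) as D.
    rewrite sin_0, !Rminus_0_r in D; apply D; intros t Ht.
    - apply is_derive_sin.
    - apply (is_derive_id t).
    - apply continuity_sin.
    - apply derivable_continuous_pt, derivable_pt_id.
    - apply Rabs_le, COS_bound. }
  unfold Rdiv; rewrite Rabs_mult, (Rabs_pos_eq (/ _)) by (apply Rlt_le, Rinv_0_lt_compat; nra).
  apply (Rmult_le_reg_r ((INR n + 1) ^ 2)); [nra|].
  rewrite Rmult_assoc, Rinv_l by nra; rewrite Rmult_1_r.
  eapply Rle_trans; [exact Sy|]; unfold y.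
  assert (0 <= 2 * PI * x) by nra.
  replace (2 * PI * (INR n + 1) * x) with (2 * PI * x * (INR n + 1)) by ring.
  apply Rmult_le_compat_l; [assumption | nra]. }
destruct (le_lt_dec N M) as [HN|HN].
- eapply Rle_trans; [apply A; exact HN|].
  apply le_INR in HN; assert (0 <= 2 * PI * x) by nra; nra.
- assert (B : forall n, (M <= n)%nat ->
    Rabs (sum1 (fun k => sin (2 * PI * INR k * x) / INR k ^ 2) n)
    <= 2 * PI * x * INR M
       + (sum1 (fun k => / INR k ^ 2) n - sum1 (fun k => / INR k ^ 2) M)).
  { induction 1 as [|n Hn IH]; [specialize (A M (le_n M)); lra|].
    rewrite !sum1_S; eapply Rle_trans; [apply Rabs_triang|].
    assert (Rabs (sin (2 * PI * INR (S n) * x) / INR (S n) ^ 2) <= / INR (S n) ^ 2); [|lra].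
    pose proof (inv_pow_bounds (S n) 2 ltac:(lia) ltac:(lia)).
    unfold Rdiv; rewrite Rabs_mult, (Rabs_pos_eq (/ _)) by lra.
    assert (Rabs (sin (2 * PI * INR (S n) * x)) <= 1) by apply Rabs_le, SIN_bound.
    nra. }
  eapply Rle_trans; [apply B; lia|].
  pose proof (sum_inv_square_tail M N ltac:(lia)).
  assert (0 < / INR N) by (apply Rinv_0_lt_compat, lt_0_INR; lia).
  lra.
Qed.

(** Smallness near 0, uniformly in [N]; it replaces the estimate of the derivative
    where that one degenerates. *)
Lemma defect_1_small N M x :
  (1 <= M)%nat -> 0 < x <= 1 / 4 ->
  Rabs (defect 1 N x) <= 4 * x + Rabs (log_part 1 x) + (x * INR M + / INR M).
Proof.
intros HM Hx; pose proof PI_RGT_0; pose proof PI2_1.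
assert (Z : Rabs (zeta_part 1 N x) <= 4 * x).
{ eapply Rle_trans; [apply sum1_Rabs|].
  apply (Rle_trans _ (sum1 (fun n => 2 * x * / INR n ^ 2) N)).
  2:{ rewrite sum1_scal; pose proof (sum_inv_square_le N); nra. }
  apply sum1_le; intros n Hn.
  assert (Hn1 : 1 <= INR n) by (apply (le_INR 1); lia).
  pose proof (zeta_bounds (2 * n) ltac:(lia)) as Hz; rewrite mult_INR in Hz; change (INR 2) with 2 in Hz.
  assert (Hxn : 0 <= x ^ (2 * n + 1) <= x).
  { split; [apply pow_le; lra|].
    rewrite pow_add, pow_1; assert (0 <= x ^ (2 * n) <= 1); [|nra].
    split; [apply pow_le; lra | rewrite <- (pow1 (2 * n)); apply pow_incr; lra]. }
  cbn [prod_from]; rewrite Rmult_1_l, plus_INR, mult_INR.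
  change (INR 2) with 2; change (INR (1 + 0)) with 1.
  assert (Hd : 0 < / (INR n * (2 * INR n + 1)) <= / INR n ^ 2).
  { split; [apply Rinv_0_lt_compat | apply Rinv_le_contravar]; nra. }
  unfold Rdiv; rewrite Rabs_pos_eq by (repeat apply Rmult_le_pos; lra).
  apply Rmult_le_compat; try lra; [apply Rmult_le_pos; lra | apply Rmult_le_compat; lra]. }
assert (Q : poly_part 1 N x = 0).
{ unfold poly_part; rewrite sum1_S, sum1_0; unfold initial_value.
  change (INR 1) with 1; rewrite Rmult_1_l, cos_PI2; unfold Rdiv; ring. }
assert (C : cos_part 1 N x = / (2 * PI) * sum1 (fun k => sin (2 * PI * INR k * x) / INR k ^ 2) N).
{ rewrite <- sum1_scal; apply sum1_ext; intros k Hk.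
  assert (0 < INR k) by (apply lt_0_INR; lia).
  change (INR 1) with 1; rewrite Rmult_1_l, <- cos_neg.
  replace (- (2 * PI * INR k * x - PI / 2)) with (PI / 2 - 2 * PI * INR k * x) by ring.
  rewrite cos_shift; field; lra. }
assert (CB : Rabs (cos_part 1 N x) <= x * INR M + / INR M).
{ rewrite C, Rabs_mult, Rabs_pos_eq by (apply Rlt_le, Rinv_0_lt_compat; lra).
  pose proof (sine_sum_small N M x HM ltac:(lra)) as B.
  assert (0 < INR M) by (apply lt_0_INR; lia).
  assert (0 < / INR M) by (apply Rinv_0_lt_compat; lra).
  apply (Rmult_le_reg_l (2 * PI)); [lra|].
  rewrite <- Rmult_assoc, Rinv_r, Rmult_1_l by lra; nra. }
unfold defect; rewrite Q, Rminus_0_r.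
revert Z CB; unfold Rabs; repeat destruct Rcase_abs; lra.
Qed.

(** Below a small [r] the previous lemma applies; from [r] on, [defect 1 N] varies
    by at most the supremum of [defect 0 N] on [[r, 1/4]], which is of order
    [1/N]. *)
Lemma defect_1_uniform e :
  0 < e -> exists N0, forall N x, (N0 <= N)%nat -> 0 < x <= 1 / 4 -> Rabs (defect 1 N x) <= e.
Proof.
intros He.
destruct (archimed_cor1 (e / 8)) as [M [HM1 HM2]]; [lra|].
assert (HM0 : 0 < INR M) by (apply lt_0_INR; lia).
assert (Clog := log_part_continuous_0 0).
destruct (Clog (e / 8)) as [d [Hd Hlog]]; [lra|].
(* The four bounds: stay in [(0, 1/4]], make [log_part] small, and give [e/8] each
   to [4 x] and [x M]. *)
pose (r := Rmin (1 / 4) (Rmin (d / 2) (Rmin (e / 32) (e / (8 * INR M))))).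
assert (R1 : r <= 1 / 4) by apply Rmin_l.
assert (R2 : r <= d / 2) by (eapply Rle_trans; [apply Rmin_r | apply Rmin_l]).
assert (R3 : r <= e / 32)
  by (eapply Rle_trans; [apply Rmin_r | eapply Rle_trans; [apply Rmin_r | apply Rmin_l]]).
assert (R4 : r <= e / (8 * INR M))
  by (eapply Rle_trans; [apply Rmin_r | eapply Rle_trans; [apply Rmin_r | apply Rmin_r]]).
assert (Hr : 0 < r).
{ repeat apply Rmin_pos; try lra; apply Rdiv_lt_0_compat; lra. }
assert (Near : forall N x, 0 < x <= r -> Rabs (defect 1 N x) <= e / 2).
{ intros N x Hx.
  eapply Rle_trans; [apply (defect_1_small N M); [lia | lra]|].
  assert (Rabs (log_part 1 x) < e / 8).
  { specialize (Hlog x); rewrite log_part_0 in Hlog.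
    assert (G : D_x no_cond 0 x /\ Rabs (x - 0) < d).
    { split; [split; [exact I | lra]|]; rewrite Rminus_0_r, Rabs_pos_eq; lra. }
    apply Hlog in G; simpl in G; unfold Rdist in G; rewrite Rminus_0_r in G; exact G. }
  assert (x * INR M <= e / 8).
  { replace (e / 8) with (e / (8 * INR M) * INR M) by (field; lra).
    apply Rmult_le_compat_r; lra. }
  lra. }
pose proof PI_RGT_0.
set (s := sin (PI * r)).
assert (Hs : 0 < s) by (apply sin_gt_0; nra).
pose (K := 4 + 7 / s ^ 2).
assert (HK : 0 < K).
{ unfold K; assert (0 < 7 / s ^ 2) by (apply Rdiv_lt_0_compat; nra); lra. }
destruct (archimed_cor1 (e / (2 * K))) as [N0 [HN1 HN2]]; [apply Rdiv_lt_0_compat; lra|].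
exists N0; intros N x HN Hx.
destruct (Rle_dec x r) as [Hxr|Hxr]; [pose proof (Near N x ltac:(lra)); lra|].
pose proof (derive_dominated (defect 1 N) (fun t => e / 2 * t) (defect 0 N) (fun _ => e / 2) r x ltac:(lra)) as D.
assert (B : Rabs (defect 1 N x - defect 1 N r) <= e / 2 * x - e / 2 * r).
{ apply D.
  - intros t Ht; apply defect_derive; lra.
  - intros t Ht; auto_derive; [exact I | ring].
  - intros t Ht; apply defect_continuous; lra.
  - intros t Ht; apply derivable_continuous_pt; reg.
  - intros t Ht; eapply Rle_trans; [apply defect_0_bound; lra|].
    assert (HNr : INR N0 <= INR N) by now apply le_INR.
    assert (0 < INR N0) by (apply lt_0_INR; lia).
    assert (St : s <= sin (PI * t)) by (apply sin_incr_1; nra).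
    apply (Rle_trans _ (/ INR N0 * K)).
    + apply (Rle_trans _ (/ (INR N + 1) * K)).
      * unfold K, Rdiv; rewrite Rinv_mult, Rmult_plus_distr_l.
        assert (/ sin (PI * t) ^ 2 <= / s ^ 2) by (apply Rinv_le_contravar; nra).
        assert (0 < / (INR N + 1)) by (apply Rinv_0_lt_compat; lra).
        nra.
      * apply Rmult_le_compat_r; [lra | apply Rinv_le_contravar; lra].
    + apply (Rmult_lt_compat_r K) in HN1; [|assumption].
      replace (e / (2 * K) * K) with (e / 2) in HN1 by (field; lra); lra. }
pose proof (Near N r ltac:(lra)).
assert (e / 2 * x - e / 2 * r <= e / 2) by nra.
revert B H0; unfold Rabs; repeat destruct Rcase_abs; lra.
Qed.

Lemma defect_uniform m e :
  0 < e -> exists N0, forall N x, (N0 <= N)%nat -> 0 < x <= 1 / 4 -> Rabs (defect (S m) N x) <= e.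
Proof.
intros He; induction m as [|m [N0 IH]]; [now apply defect_1_uniform|].
exists N0; intros N x HN Hx.
apply (Rle_trans _ (e * x)); [|nra].
apply defect_step; [lra | intros t Ht; apply IH; [exact HN | lra]].
Qed.

Lemma defect_lim m : is_lim_seq (fun N => defect (S m) N (1 / 4)) 0.
Proof.
apply is_lim_seq_spec; intros e.
destruct (defect_uniform m (e / 2)) as [N0 H]; [destruct e; simpl; lra|].
exists N0; intros N HN; specialize (H N (1 / 4) HN ltac:(lra)).
rewrite Rminus_0_r; destruct e; simpl in *; lra.
Qed.


(** * Evaluation at one quarter *)

Lemma sum1_pairs f n : sum1 f (2 * n) = sum1 (fun i => f (2 * i - 1)%nat + f (2 * i)%nat) n.
Proof.
induction n as [|n IH]; [now rewrite !sum1_0|].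
replace (2 * S n)%nat with (S (S (2 * n))) by lia; rewrite !sum1_S, IH.
replace (2 * S n - 1)%nat with (S (2 * n)) by lia; replace (2 * S n)%nat with (S (S (2 * n))) by lia.
ring.
Qed.

Lemma is_lim_seq_mul_index (u : nat -> R) (l : R) c :
  (1 <= c)%nat -> is_lim_seq u l -> is_lim_seq (fun n => u (c * n)%nat) l.
Proof.
intros Hc; apply (is_lim_seq_subseq u l (fun n => (c * n)%nat)).
apply eventually_subseq; intros n; nia.
Qed.

Lemma cos_quarter_even i : cos (INR (2 * i) * (PI / 2)) = (-1) ^ i.
Proof.
rewrite <- cos_INR_PI, mult_INR; f_equal; change (INR 2) with 2; field.
Qed.

Lemma cos_quarter_odd i : cos (INR (2 * i + 1) * (PI / 2)) = 0.
Proof.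
rewrite plus_INR, mult_INR; change (INR 2) with 2; change (INR 1) with 1.
replace ((2 * INR i + 1) * (PI / 2)) with (INR i * PI + PI / 2) by field.
rewrite cos_plus, cos_PI2, sin_PI2, sin_INR_PI; ring.
Qed.

Lemma cos_difference k m :
  cos (2 * PI * INR k * (1 / 4) - INR m * (PI / 2))
  = cos (INR (k + m) * (PI / 2)) * (-1) ^ m.
Proof.
rewrite <- cos_INR_PI, plus_INR.
replace (2 * PI * INR k * (1 / 4) - INR m * (PI / 2)) with ((INR k + INR m) * (PI / 2) - INR m * PI) by field.
rewrite cos_minus, sin_INR_PI; ring.
Qed.

Lemma cos_part_ex_lim m : (1 <= m)%nat -> exists l : R, is_lim_seq (fun N => cos_part m N (1 / 4)) l.
Proof.
intros Hm; pose proof PI_RGT_0; pose proof PI2_1.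
destruct (inv_pow_summable
  (fun k => cos (2 * PI * INR (S k) * (1 / 4) - INR m * (PI / 2)) / ((2 * PI * INR (S k)) ^ m * INR (S k)))
  (m + 1) ltac:(lia)) as [l Hl].
- intros k; assert (0 < INR (S k)) by (apply lt_0_INR; lia).
  assert (0 < INR (S k) ^ m) by now apply pow_lt.
  assert (1 <= (2 * PI) ^ m) by (apply pow_R1_Rle; lra).
  unfold Rdiv; rewrite Rabs_mult, (Rabs_pos_eq (/ _)).
  2:{ apply Rlt_le, Rinv_0_lt_compat, Rmult_lt_0_compat; [apply pow_lt; nra | assumption]. }
  rewrite <- (Rmult_1_l (/ INR (S k) ^ (m + 1))).
  apply Rmult_le_compat; [apply Rabs_pos | | apply Rabs_le, COS_bound |].
  + apply Rlt_le, Rinv_0_lt_compat, Rmult_lt_0_compat; [apply pow_lt; nra | assumption].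
  + rewrite Rpow_mult_distr, pow_add, pow_1, Rmult_assoc.
    assert (0 < INR (S k) ^ m * INR (S k)) by now apply Rmult_lt_0_compat.
    apply Rinv_le_contravar; [assumption | nra].
- exists l; apply (is_series_sum1
    (fun k => cos (2 * PI * INR k * (1 / 4) - INR m * (PI / 2)) / ((2 * PI * INR k) ^ m * INR k))).
  exact Hl.
Qed.

(** Full convergence being known, a subsequence suffices; it will be chosen so
    that the terms group by residue of [k] modulo 2 or 4. *)
Lemma cos_part_lim_subseq m c (l : R) :
  (1 <= m)%nat -> (1 <= c)%nat ->
  is_lim_seq (fun N => cos_part m (c * N) (1 / 4)) l ->
  is_lim_seq (fun N => cos_part m N (1 / 4)) l.
Proof.
intros Hm Hc Hl; destruct (cos_part_ex_lim m Hm) as [l' Hl'].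
pose proof (is_lim_seq_mul_index _ l' c Hc Hl') as H'.
apply is_lim_seq_unique in Hl; apply is_lim_seq_unique in H'.
assert (E : Finite l = Finite l') by congruence.
rewrite E; exact Hl'.
Qed.

(** Only odd frequencies [k] survive at [x = 1/4], with alternating signs. *)
Lemma cos_part_lim_odd p :
  is_lim_seq (fun N => cos_part (2 * p + 1) N (1 / 4))
    ((-1) ^ p / (2 * PI) ^ (2 * p + 1) * dirichlet_beta (INR (2 * p + 2))).
Proof.
pose proof PI_RGT_0.
apply (cos_part_lim_subseq _ 2); [lia | lia|].
apply (is_lim_seq_ext (fun N => (-1) ^ p / (2 * PI) ^ (2 * p + 1)
    * sum1 (fun k => (-1) ^ (k - 1) / INR (2 * k - 1) ^ (2 * p + 2)) N)).
2:{ apply (is_lim_seq_scal_l _ _ (dirichlet_beta (INR (2 * p + 2)))), beta_lim; lia. }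
intros N; unfold cos_part; rewrite sum1_pairs, <- sum1_scal; apply sum1_ext; intros i Hi.
rewrite !cos_difference.
replace (2 * i + (2 * p + 1))%nat with (2 * (i + p) + 1)%nat by lia.
replace (2 * i - 1 + (2 * p + 1))%nat with (2 * (i + p))%nat by lia.
rewrite cos_quarter_odd, cos_quarter_even.
assert (0 < INR (2 * i - 1)) by (apply lt_0_INR; lia).
replace ((-1) ^ (2 * p + 1)) with (-1) by (rewrite Nat.add_1_r; symmetry; apply pow_1_odd).
replace ((-1) ^ (i + p)) with (- ((-1) ^ (i - 1) * (-1) ^ p))
  by (replace (i + p)%nat with (S (i - 1 + p)) by lia; rewrite <- tech_pow_Rmult, pow_add; ring).
replace (2 * p + 2)%nat with (S (2 * p + 1)) by lia.
rewrite !Rpow_mult_distr, <- tech_pow_Rmult.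
field; repeat split; try apply pow_nonzero; try lra; apply not_0_INR; lia.
Qed.

(** Changing the sign of the odd terms: the alternating sum is twice the even part
    minus the whole. *)
Lemma alternating_zeta_lim s :
  (2 <= s)%nat ->
  is_lim_seq (fun M => sum1 (fun i => (-1) ^ i / INR i ^ s) (2 * M))
    ((2 / 2 ^ s - 1) * zeta (INR s)).
Proof.
intros Hs; pose proof (zeta_lim s Hs) as Z.
replace ((2 / 2 ^ s - 1) * zeta (INR s)) with (2 / 2 ^ s * zeta (INR s) - zeta (INR s)) by ring.
apply (is_lim_seq_ext (fun M => 2 / 2 ^ s * sum1 (fun k => / INR k ^ s) M
                                - sum1 (fun k => / INR k ^ s) (2 * M))).
- intros M; rewrite !sum1_pairs, <- sum1_scal, <- sum1_minus; apply sum1_ext; intros i Hi.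
  rewrite pow_1_even; replace ((-1) ^ (2 * i - 1)) with (-1).
  2:{ replace (2 * i - 1)%nat with (S (2 * (i - 1))) by lia; symmetry; apply pow_1_odd. }
  rewrite (mult_INR 2 i), Rpow_mult_distr; change (INR 2) with 2.
  field; repeat split; apply pow_nonzero; try lra; apply not_0_INR; lia.
- apply is_lim_seq_minus'; [apply (is_lim_seq_scal_l _ _ (zeta (INR s))); exact Z|].
  apply (is_lim_seq_mul_index (sum1 (fun k => / INR k ^ s))); [lia | exact Z].
Qed.

(** Only even frequencies [k = 2i] survive at [x = 1/4], with sign [(-1)^i]. *)
Lemma cos_part_lim_even p :
  (1 <= p)%nat ->
  is_lim_seq (fun N => cos_part (2 * p) N (1 / 4))
    ((-1) ^ p / ((2 * PI) ^ (2 * p) * 2 ^ (2 * p + 1))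
       * ((2 / 2 ^ (2 * p + 1) - 1) * zeta (INR (2 * p + 1)))).
Proof.
intros Hp; pose proof PI_RGT_0.
apply (cos_part_lim_subseq _ 4); [lia | lia|].
apply (is_lim_seq_ext (fun M => (-1) ^ p / ((2 * PI) ^ (2 * p) * 2 ^ (2 * p + 1))
    * sum1 (fun i => (-1) ^ i / INR i ^ (2 * p + 1)) (2 * M))).
2:{ apply (is_lim_seq_scal_l _ _ ((2 / 2 ^ (2 * p + 1) - 1) * zeta (INR (2 * p + 1)))), alternating_zeta_lim; lia. }
intros M; unfold cos_part.
replace (4 * M)%nat with (2 * (2 * M))%nat by lia.
rewrite (sum1_pairs _ (2 * M)), <- sum1_scal; apply sum1_ext; intros i Hi.
rewrite !cos_difference.
replace (2 * i + 2 * p)%nat with (2 * (i + p))%nat by lia.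
replace (2 * i - 1 + 2 * p)%nat with (2 * (i - 1 + p) + 1)%nat by lia.
rewrite cos_quarter_odd, cos_quarter_even.
assert (0 < INR i) by (apply lt_0_INR; lia).
rewrite pow_1_even, mult_INR; change (INR 2) with 2.
rewrite !pow_add, !pow_1, !Rpow_mult_distr.
assert (INR (2 * i - 1) <> 0) by (apply not_0_INR; lia).
field; repeat split; try apply pow_nonzero; lra.
Qed.

(** Odd orders [j] drop out because [cos(j PI/2) = 0]. *)
Lemma poly_part_lim m x :
  (1 <= m)%nat ->
  is_lim_seq (fun N => poly_part m N x)
    (sum1 (fun k => (-1) ^ k / (2 * PI) ^ (2 * k) * zeta (INR (2 * k + 1))
                    * (x ^ (m - 2 * k) / INR (fact (m - 2 * k)))) (m / 2)).
Proof.
intros Hm.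
pose (f := fun j => cos (INR j * (PI / 2)) / (2 * PI) ^ j * zeta (INR (j + 1))
                    * (x ^ (m - j) / INR (fact (m - j)))).
assert (H : is_lim_seq (fun N => poly_part m N x) (sum1 f m)).
{ apply (is_lim_seq_sum1 (fun j N => initial_value N j * (x ^ (m - j) / INR (fact (m - j))))).
  intros j Hj; unfold f, initial_value.
  apply (is_lim_seq_scal_r _ _ (cos (INR j * (PI / 2)) / (2 * PI) ^ j * zeta (INR (j + 1)))).
  apply (is_lim_seq_scal_l _ _ (zeta (INR (j + 1)))), zeta_lim; lia. }
assert (E : sum1 f (2 * (m / 2)) =
  sum1 (fun k => (-1) ^ k / (2 * PI) ^ (2 * k) * zeta (INR (2 * k + 1))
                    * (x ^ (m - 2 * k) / INR (fact (m - 2 * k)))) (m / 2)).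
{ rewrite sum1_pairs; apply sum1_ext; intros k Hk; unfold f at 2; rewrite cos_quarter_even.
  unfold f; replace (2 * k - 1)%nat with (2 * (k - 1) + 1)%nat by lia; rewrite cos_quarter_odd.
  unfold Rdiv; ring. }
rewrite <- E; clear E.
destruct (Nat.Even_or_Odd m) as [[p ->]|[p ->]].
- replace (2 * p / 2)%nat with p by (symmetry; rewrite Nat.mul_comm; apply Nat.div_mul; lia); exact H.
- replace ((2 * p + 1) / 2)%nat with p
    by (apply (Nat.div_unique _ _ _ 1); lia).
  assert (E : sum1 f (2 * p + 1) = sum1 f (2 * p)); [|rewrite <- E; exact H].
  rewrite Nat.add_1_r, sum1_S; unfold f at 2.
  rewrite <- (Nat.add_1_r (2 * p)), cos_quarter_odd; unfold Rdiv; ring.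
Qed.

(** The defect of level [S m] tends to 0 at [x = 1/4]; multiply by [4^(S m)]. The
    polynomial part runs up to half of [S m] inclusive; for even [S m] its last
    term is a multiple of [zeta(S m + 1)], to be joined with the limit [l]. *)
Lemma zeta_series_from_cos_lim m (l : R) :
  is_lim_seq (fun N => cos_part (S m) N (1 / 4)) l ->
  is_series
    (fun j : nat => let n := S j in
       zeta (INR (2 * n)) / (INR n * prod_from (fun i => INR (2 * n + i)) 1 (S m) * 16 ^ n))
    (4 ^ S m * l
     - sum1 (fun k => (-4) ^ k * zeta (INR (2 * k + 1)) / (INR (fact (S m - 2 * k)) * PI ^ (2 * k)))
         (S m / 2)
     + (ln (PI / 2) - harmonic (S m)) / INR (fact (S m))).
Proof.
intros Hl; pose proof PI_RGT_0.
pose proof (defect_lim m) as HD.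
pose proof (poly_part_lim (S m) (1 / 4) ltac:(lia)) as HP.
set (pl := sum1 _ _) in HP.
assert (HZ : is_lim_seq (fun N => 4 ^ S m * zeta_part (S m) N (1 / 4))
               (4 ^ S m * (0 + (log_part (S m) (1 / 4) + (l - pl))))).
{ apply (is_lim_seq_scal_l _ _ (0 + (log_part (S m) (1 / 4) + (l - pl)))).
  apply (is_lim_seq_ext (fun N => defect (S m) N (1 / 4)
           + (log_part (S m) (1 / 4) + (cos_part (S m) N (1 / 4) - poly_part (S m) N (1 / 4))))).
  { intros N; unfold defect; ring. }
  apply is_lim_seq_plus'; [exact HD|]; apply is_lim_seq_plus'; [apply is_lim_seq_const|].
  now apply is_lim_seq_minus'. }
assert (Q : forall n, (1 / 4) ^ n = / 4 ^ n) by (intros n; rewrite <- pow_inv; f_equal; lra).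
apply (is_series_sum1 (fun n => zeta (INR (2 * n))
   / (INR n * prod_from (fun i => INR (2 * n + i)) 1 (S m) * 16 ^ n))).
match goal with |- is_lim_seq _ (Finite ?a) => replace a with (4 ^ S m * (0 + (log_part (S m) (1 / 4) + (l - pl)))) end.
- revert HZ; apply is_lim_seq_ext; intros N; unfold zeta_part; rewrite <- sum1_scal.
  apply sum1_ext; intros n Hn.
  pose proof (prod_from_pos n (S m) ltac:(lia)).
  set (q := prod_from _ _ _) in *.
  rewrite Q, pow_add, pow_mult; replace (4 ^ 2) with 16 by ring.
  field; repeat split; try apply pow_nonzero; try lra; apply not_0_INR; lia.
- assert (EL : 4 ^ S m * log_part (S m) (1 / 4) = (ln (PI / 2) - harmonic (S m)) / INR (fact (S m))).
  { unfold log_part; rewrite Q; replace (2 * PI * (1 / 4)) with (PI / 2) by field.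
    field; split; [apply INR_fact_neq_0 | apply pow_nonzero; lra]. }
  rewrite <- EL.
  assert (EP : sum1 (fun k => (-4) ^ k * zeta (INR (2 * k + 1)) / (INR (fact (S m - 2 * k)) * PI ^ (2 * k)))
         (S m / 2) = 4 ^ S m * pl).
  { unfold pl; rewrite <- sum1_scal; apply sum1_ext; intros k Hk.
    assert (Hk2 : (2 * k <= S m)%nat) by (pose proof (Nat.Div0.mul_div_le (S m) 2); lia).
    rewrite Q.
    replace (4 ^ S m) with (4 ^ (S m - 2 * k) * 4 ^ (2 * k)) by (rewrite <- pow_add; f_equal; lia).
    rewrite Rpow_mult_distr; replace (2 ^ (2 * k)) with (4 ^ k) by (rewrite pow_mult; f_equal; ring).
    replace ((-4) ^ k) with ((-1) ^ k * 4 ^ k) by (rewrite <- Rpow_mult_distr; f_equal; ring).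
    replace (4 ^ (2 * k)) with (4 ^ k * 4 ^ k) by (rewrite <- pow_add; f_equal; lia).
    field; repeat split; try apply INR_fact_neq_0; apply pow_nonzero; lra. }
  rewrite EP; ring.
Qed.

Lemma kronecker_refl a : kronecker a a = 1.
Proof. unfold kronecker; destruct (Req_dec_T a a); [reflexivity | contradiction]. Qed.

Lemma kronecker_neq a b : a <> b -> kronecker a b = 0.
Proof. intros H; unfold kronecker; destruct (Req_dec_T a b); [contradiction | reflexivity]. Qed.

Lemma kronecker_half_even p : kronecker (INR p) (INR (2 * p) / 2) = 1.
Proof.
replace (INR (2 * p) / 2) with (INR p); [apply kronecker_refl|].
rewrite mult_INR; change (INR 2) with 2; field.
Qed.

Lemma kronecker_half_odd p : kronecker (INR p) (INR (2 * p + 1) / 2) = 0.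
Proof.
apply kronecker_neq; rewrite plus_INR, mult_INR; change (INR 2) with 2; change (INR 1) with 1; lra.
Qed.

Theorem mainTheorem7 (m : nat) (hm : (1 <= m)%nat) :
  is_series
    (fun j : nat =>
       let n := S j in
       zeta (INR (2 * n)) /
         (INR n * prod_from (fun i => INR (2 * n + i)) 1 m * 16 ^ n))
    (kronecker (INR ((m + 1) / 2)) (INR (m + 1) / 2) *
       ((-1) ^ ((3 * m + 1) / 2) * 2 ^ m * dirichlet_beta (INR (m + 1)) / PI ^ m)
     - 1 / 2 *
       (kronecker (INR (m / 2)) (INR m / 2) *
         ((-1) ^ (3 * m / 2) * (2 ^ (2 * m + 1) + 2 ^ m - 1) * zeta (INR (m + 1))
            / (2 * PI) ^ m))
     - sum_n_m
         (fun k : nat =>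
            (-4) ^ k * zeta (INR (2 * k + 1)) /
              (INR (fact (m - 2 * k)) * PI ^ (2 * k)))
         1 ((m - 1) / 2)
     + (ln (PI / 2) - harmonic m) / INR (fact m)).
Proof.
pose proof PI_RGT_0.
assert (Half : forall q r, (r < 2)%nat -> ((2 * q + r) / 2 = q)%nat).
{ intros q r Hr; symmetry; now apply (Nat.div_unique _ _ _ r). }
destruct (Nat.Even_or_Odd m) as [[p Hp]|[p Hp]].
- (* The term [k = m/2] of the polynomial part contributes [2^(2m+1)] and the
     cosine part contributes [2^m - 1]. *)
  destruct p as [|p]; [lia|].
  pose proof (cos_part_lim_even (S p) ltac:(lia)) as HC; rewrite <- Hp in HC.
  replace ((m + 1) / 2)%nat with (S p) by (rewrite Hp; symmetry; apply Half; lia).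
  replace (m / 2)%nat with (S p) by (rewrite Hp, <- (Nat.add_0_r (2 * S p)); symmetry; apply Half; lia).
  replace (3 * m / 2)%nat with (2 * S p + S p)%nat
    by (symmetry; replace (3 * m)%nat with (2 * (2 * S p + S p) + 0)%nat by lia; apply Half; lia).
  replace ((m - 1) / 2)%nat with p
    by (symmetry; replace (m - 1)%nat with (2 * p + 1)%nat by lia; apply Half; lia).
  replace (kronecker (INR (S p)) (INR (m + 1) / 2)) with 0 by (rewrite Hp; symmetry; apply kronecker_half_odd).
  replace (kronecker (INR (S p)) (INR m / 2)) with 1 by (rewrite Hp; symmetry; apply kronecker_half_even).
  rewrite pow_add, pow_1_even.
  destruct m as [|m]; [lia|].
  pose proof (zeta_series_from_cos_lim m _ HC) as HS.
  replace (S m / 2)%nat with (S p) in HS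
    by (rewrite Hp, <- (Nat.add_0_r (2 * S p)); symmetry; apply Half; lia).
  rewrite sum1_S in HS.
  match goal with |- is_series _ ?b => match type of HS with is_series _ ?a => replace b with a; [exact HS|] end end.
  unfold sum1.
  set (sg := sum_n_m _ _ _); set (lg := (ln _ - _) / _).
  rewrite <- Hp, Nat.sub_diag; simpl (fact 0); simpl (INR 1).
  replace ((-4) ^ S p) with ((-1) ^ S p * 2 ^ S m)
    by (rewrite Hp, pow_mult, <- Rpow_mult_distr; f_equal; ring).
  replace (4 ^ S m) with (2 ^ S m * 2 ^ S m) by (rewrite <- Rpow_mult_distr; f_equal; ring).
  replace (2 ^ (2 * S m + 1)) with (2 * (2 ^ S m * 2 ^ S m))
    by (rewrite pow_add, pow_1, Nat.mul_comm, pow_mult; ring).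
  rewrite pow_add, pow_1, Rpow_mult_distr.
  set (z := zeta _).
  assert (2 ^ S m <> 0) by (apply pow_nonzero; lra).
  assert (PI ^ S m <> 0) by (apply pow_nonzero; lra).
  set (t := 2 ^ S m) in *; set (w := PI ^ S m) in *; field; split; assumption.
- pose proof (cos_part_lim_odd p) as HC; rewrite <- Hp in HC.
  replace (2 * p + 2)%nat with (m + 1)%nat in HC by lia.
  replace ((m + 1) / 2)%nat with (p + 1)%nat
    by (symmetry; replace (m + 1)%nat with (2 * (p + 1) + 0)%nat by lia; apply Half; lia).
  replace (m / 2)%nat with p by (rewrite Hp; symmetry; apply Half; lia).
  replace ((3 * m + 1) / 2)%nat with (2 * (p + 1) + p)%nat
    by (symmetry; replace (3 * m + 1)%nat with (2 * (2 * (p + 1) + p) + 0)%nat by lia; apply Half; lia).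
  replace ((m - 1) / 2)%nat with p
    by (symmetry; replace (m - 1)%nat with (2 * p + 0)%nat by lia; apply Half; lia).
  replace (kronecker (INR (p + 1)) (INR (m + 1) / 2)) with 1
    by (replace (m + 1)%nat with (2 * (p + 1))%nat by lia; symmetry; apply kronecker_half_even).
  replace (kronecker (INR p) (INR m / 2)) with 0 by (rewrite Hp; symmetry; apply kronecker_half_odd).
  rewrite pow_add, pow_1_even.
  destruct m as [|m]; [lia|].
  pose proof (zeta_series_from_cos_lim m _ HC) as HS.
  replace (S m / 2)%nat with p in HS by (rewrite Hp; symmetry; apply Half; lia).
  match goal with |- is_series _ ?b => match type of HS with is_series _ ?a => replace b with a; [exact HS|] end end.
  unfold sum1.
  set (sg := sum_n_m _ _ _); set (lg := (ln _ - _) / _).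
  replace (4 ^ S m) with (2 ^ S m * 2 ^ S m) by (rewrite <- Rpow_mult_distr; f_equal; ring).
  rewrite (Rpow_mult_distr 2 PI).
  set (z := dirichlet_beta _).
  assert (2 ^ S m <> 0) by (apply pow_nonzero; lra).
  assert (PI ^ S m <> 0) by (apply pow_nonzero; lra).
  set (t := 2 ^ S m) in *; set (w := PI ^ S m) in *; field; split; assumption.
Qed.
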